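(* Let $q\in\mathbb{N}$, $q\ge1$, let $\mathbf{a}=(a_1,\dots,a_q)\in\mathbb{R}^q$, and let $\{\xi_i\}_{i\ge -q}$ be i.i.d. real random variables with continuous distribution function $F$. Let $Z_i:=\xi_i+\sum_{j=1}^q a_j\xi_{i-j}$ for $i\ge0$, and assume $\mathbb{P}(Z_0\ge0)<1$. Then there is a number $\beta_F(\mathbf{a})\in[0,1)$ such that $$\lim_{n\to\infty}\frac1n\log\mathbb{P}\Big(\min_{0\le i\le n}Z_i\ge0\Big)=\log\beta_F(\mathbf{a}).$$ Further, if $\beta_F(\mathbf{a})>0$, then $\beta_F(\mathbf{a})$ is the largest eigenvalue of the operator $K:\mathcal{C}_b(\mathbb{R}^q)\to\mathcal{C}_b(\mathbb{R}^q)$ defined by $$Kg(x_1,\dots,x_q)=\int_{\{y:\;y+\sum_{j=1}^q a_jx_{q+1-j}>0\}}g(x_2,\dots,x_q,y)\,F(dy),$$ and the corresponding eigenfunction $\psi$ is non-negative and continuous.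
   Context: $\mathcal{C}_b(\mathbb{R}^q)$ is the space of bounded continuous real functions on $\mathbb{R}^q$ with the sup norm. Convention: $\log0=-\infty$. *)

(* Defs.v *)
From HB Require Import structures.
From mathcomp Require Import all_boot all_order all_algebra finmap.
From mathcomp Require Import all_classical all_reals all_analysis.

Set Implicit Arguments.
Unset Strict Implicit.
Unset Printing Implicit Defensive.

Import Order.TTheory GRing.Theory Num.Theory.
Import numFieldNormedType.Exports.

Local Open Scope classical_set_scope.
Local Open Scope ring_scope.

Definition mutually_independent (d : measure_display) (T : measurableType d)
    (R : realType) (P : probability T R) (I : choiceType) (D : set I)
    (X : I -> {RV P >-> R}) : Prop :=
  forall (J : {fset I}) (B : I -> set R),
    [set` J] `<=` D -> (forall i, measurable (B i)) ->
    P (\bigcap_(i in [set` J]) (X i @^-1` B i)) =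
    (\prod_(i <- J) P (X i @^-1` B i))%E.

Section MovingAverage.
Variables (R : realType) (q : nat).

(* The coordinates of [a] and of [x] are numbered from 0: [a 0 j] is the
   coefficient a_(j+1), and [x 0 k] is x_(k+1). *)
Definition moving_average (T : Type) (a : 'rV[R]_q) (xi : int -> T -> R)
    (i : nat) (w : T) : R :=
  xi i%:Z w + \sum_(j < q) a 0 j * xi (i%:Z - j.+1%:Z) w.

(* (x_1, ..., x_q), y |-> (x_2, ..., x_q, y); [insub k.+1] is [None] exactly
   at the last index. *)
Definition push_right (x : 'rV[R]_q) (y : R) : 'rV[R]_q :=
  \row_(k < q) (if insub k.+1 is Some k' then x 0 (k' : 'I_q) else y).

Definition bounded_continuous (g : 'rV[R]_q -> R) : Prop :=
  continuous g /\ bounded_fun g.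

(* [rev_ord j] has value q - (j + 1), so [x 0 (rev_ord j)] is
   x_(q + 1 - (j + 1)). *)
Definition persistence_operator (F : cumulativeBounded (0 : R) (1 : R))
    (a : 'rV[R]_q) (g : 'rV[R]_q -> R) (x : 'rV[R]_q) : R :=
  \int[lebesgue_stieltjes_measure F]_(y in
      [set y | 0 < y + \sum_(j < q) a 0 j * x 0 (rev_ord j)])
    g (push_right x y).

Implicit Types (K : ('rV[R]_q -> R) -> ('rV[R]_q -> R)) (lambda : R).

Definition is_eigenfunction K lambda (g : 'rV[R]_q -> R) : Prop :=
  [/\ bounded_continuous g, exists x, g x != 0 &
      forall x, K g x = lambda * g x].

Definition is_eigenvalue K lambda : Prop :=
  exists g, is_eigenfunction K lambda g.

(* The function space is real, so eigenvalues are real and are compared in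
   the order of R. *)
Definition is_largest_eigenvalue K lambda : Prop :=
  is_eigenvalue K lambda /\
  forall mu : R, is_eigenvalue K mu -> mu <= lambda.

End MovingAverage.

(* Main.v *)
Require Import Defs.
From HB Require Import structures.
From mathcomp Require Import all_boot all_order all_algebra finmap.
From mathcomp Require Import all_classical all_reals all_analysis.
From mathcomp Require Import measurable_realfun.
From mathcomp Require Import ring lra zify.

Set Implicit Arguments.
Unset Strict Implicit.
Unset Printing Implicit Defensive.

Import Order.TTheory GRing.Theory Num.Theory.
Import numFieldNormedType.Exports.

Local Open Scope classical_set_scope.
Local Open Scope ring_scope.

(** Write K for the persistence operator, L for the same operator without the
    indicator, and [mass n] for [K^n 1].

    The persistence probability p_n is the integral of [K^(n+1) 1] against the
    law of the first q variables, which is [L^q (K^(n+1) 1)] since q pushes erase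
    the initial state.  As [K <= L] on non-negative functions,
    [K^(n+1+q) 1 <= p_n <= sup (K^(n+1) 1)], so p_n has the exponential growth
    rate beta of the submultiplicative sequence [sup (K^n 1)].

    For the eigenfunction, if beta > 0 then the truncated resolvent sums
    [sum_(n < N) l^-n K^n 1] are unbounded as l decreases to beta, and normalizing
    them yields approximate eigenfunctions.  A limit exists because [K^q] is
    compact: driving two copies of the chain with the same innovations gives
    [|K^q g x - K^q g x'| <= sup |g| * sum_(j < q) |L^j K 1 x - L^j K 1 x'|],
    and the functions [L^j K 1] take values in the compact interval [0, 1]. *)

(** * Integrals against a probability on the line *)

(** One application of [K] leaves the dependence of [g] on the retained coordinates essentially
    untouched, so compactness can only be hoped for once all q of them have been replaced; hence the
    power q. The state space is not compact either, so equicontinuity for its norm would not make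
    pointwise limits uniform; the functions [L^j K 1] with j < q map the states into the cube
    [0, 1]^q, and the modulus is measured there. They arise because two copies fed with the same
    innovations have thresholds whose difference does not depend on these innovations: the same copy
    is always the more fragile one at step j, and an expected absolute difference is then the
    absolute difference of expectations.

    Continuity of [F] makes the law atomless. At a given x the survival indicator is discontinuous
    for one value of y only, so [K] preserves continuity, and the weak inequality of the event can
    be traded for the strict one of the operator.

    Maximality of beta needs no spectral theory: an eigenfunction is dominated by a constant, so its
    eigenvalue cannot exceed the growth rate of [K^n 1]. *)

(** Dominated convergence speaks of sequences only. The balls of radius 1/(n+1) form a countable
    base at x, so sequences suffice to test continuity. *)
Lemma continuous_at_seq (R : realType) (V : pseudoMetricType R) (f : V -> R)
    (x : V) :
  (forall u : nat -> V, u n @[n --> \oo] --> x -> f (u n) @[n --> \oo] --> f x) ->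
  {for x, continuous f}.
Proof.
move=> fseq; apply: contrapT => /cvgrPdist_lt /existsNP[e /not_implyP[e0 fe]].
have bad (n : nat) : exists u, ball x n.+1%:R^-1 u /\ e <= `|f x - f u|.
  apply: contrapT => /forallNP nbad; apply: fe.
  near=> u; have /not_andP[|/negP] := nbad u; last by rewrite -ltNge.
  by case; near: u; apply: nbhsx_ballx.
have [u uP] := choice bad.
have /fseq /cvgrPdist_lt /(_ _ e0) : u n @[n --> \oo] --> x.
  apply/cvg_ballP => d d0; near=> n.
  apply: (@le_ball _ _ _ n.+1%:R^-1); last by have [] := uP n.
  by apply: ltW; near: n; exact: (near_infty_natSinv_lt (PosNum d0)).
by case=> n _ /(_ n (leqnn n)) /=; rewrite ltNge; have [_ ->] := uP n.
Unshelve. all: by end_near. Qed.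

Section probability_integral.
Variables (R : realType) (mu : probability (measurableTypeR R) R).
Implicit Types (f g : R -> R) (M : R).

Lemma bounded_integrable f M : measurable_fun setT f ->
  (forall y, `|f y| <= M) -> mu.-integrable setT (EFin \o f).
Proof.
move=> mf fM; apply: measurable_bounded_integrable => //.
  by apply: le_lt_trans (probability_le1 mu measurableT) _; rewrite ltry.
exists M; split; first exact: num_real.
by move=> N MN y _; apply: le_trans (ltW MN).
Qed.

Lemma Rintegral_prob_cst (r : R) : \int[mu]_y r = r.
Proof.
by rewrite Rintegral_cst// [X in fine X](probability_setT mu) mulr1.
Qed.

Lemma bounded_Rintegral f M : measurable_fun setT f ->
  (forall y, `|f y| <= M) -> `|\int[mu]_y f y| <= M.
Proof.
move=> mf fM; have fint := bounded_integrable mf fM.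
apply: (le_trans (le_normr_Rintegral _ fint)) => //.
rewrite -[leRHS](Rintegral_prob_cst M).
apply: le_Rintegral => //.
  apply: (@bounded_integrable _ M) => [|y]; rewrite ?normr_id//.
  exact: measurableT_comp.
by apply: (@bounded_integrable _ `|M|).
Qed.

Lemma continuous_Rintegral (V : pseudoMetricType R) (f : V -> R -> R) M
    (x : V) :
  (forall u, measurable_fun setT (f u)) ->
  (forall u y, `|f u y| <= M) ->
  {ae mu, forall y, {for x, continuous (f^~ y)}} ->
  {for x, continuous (fun u => \int[mu]_y f u y)}.
Proof.
move=> mf fM fc; apply: continuous_at_seq => u ux.
have [] := @dominated_convergence _ _ _ mu setT measurableT
  (fun n y => (f (u n) y)%:E) (fun y => (f x y)%:E) (cst M%:E).
- by move=> n; apply/measurable_EFinP; exact: mf.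
- by apply/measurable_EFinP; exact: mf.
- apply: filterS fc; first exact: (ae_filter_ringOfSetsType mu).
  move=> y fy _; apply/cvg_EFin; first exact: nearW.
  exact: (cvg_comp _ _ ux fy).
- exact: (@bounded_integrable _ `|M|).
- by apply: aeW => y n _; rewrite lee_fin.
move=> ix _ cv; apply: fine_cvg.
rewrite fineK; first exact: cv.
exact: integrable_fin_num.
Qed.

End probability_integral.

(** * Transfer operators on bounded continuous functions *)

Lemma bounded_continuousP (R : realType) (q : nat) (g : 'rV[R]_q -> R) :
  bounded_continuous g <-> continuous g /\ exists M, forall x, `|g x| <= M.
Proof.
split=> -[cg].
  move=> [M [_ gM]]; split=> //; exists (M + 1) => x; apply: gM => //.
  by rewrite ltrDl.
move=> [M gM]; split=> //; exists M; split; first exact: num_real.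
by move=> N MN x _; apply: le_trans (ltW MN).
Qed.

Section shift_register.
Variables (R : realType) (q : nat).
Implicit Types (x : 'rV[R]_q) (y : R) (a : 'rV[R]_q).

Definition threshold a x : R := \sum_(j < q) a 0 j * x 0 (rev_ord j).

Lemma cvg_rV (T : Type) (G : set_system T) (f : T -> 'rV[R]_q) (l : 'rV[R]_q) :
  Filter G -> (forall j, f t 0 j @[t --> G] --> l 0 j) -> f t @[t --> G] --> l.
Proof.
move=> FG fl; apply/cvg_ballP => e e0.
have : forall j, \forall t \near G, ball (l 0 j) e (f t 0 j).
  by move=> j; have /cvg_ballP := fl j; exact.
move=> /filter_forall; apply: filterS => t tP; split=> // i j.
by rewrite ord1.
Qed.

Lemma push_rightE x y (k : 'I_q) :
  push_right x y 0 k = (if insub k.+1 is Some k' then x 0 (k' : 'I_q) else y).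
Proof. by rewrite mxE. Qed.

Lemma push_right_coord_eq (m : nat) x x' y :
  (forall k : 'I_q, (m.+1 <= k)%N -> x 0 k = x' 0 k) ->
  forall k : 'I_q, (m <= k)%N -> push_right x y 0 k = push_right x' y 0 k.
Proof.
move=> xx' k mk; rewrite !push_rightE; case: insubP => //= k' _ k'k.
by apply: xx'; rewrite k'k.
Qed.

Lemma push_right_continuousl y : continuous (fun x : 'rV[R]_q => push_right x y).
Proof.
move=> x; apply: (@cvg_rV _ (nbhs x)) => j; rewrite push_rightE.
under eq_fun do rewrite push_rightE.
case: insubP => [k' _ _|_]; last exact: cvg_cst.
exact: coord_continuous.
Qed.

Lemma push_right_continuousr x : continuous (push_right x).
Proof.
move=> y; apply: (@cvg_rV _ (nbhs y)) => j; rewrite push_rightE.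
under eq_fun do rewrite push_rightE.
by case: insubP => [k' _ _|_]; [exact: cvg_cst|exact: cvg_id].
Qed.

Lemma push_rightB x x' y : push_right x y - push_right x' y = push_right (x - x') 0.
Proof.
apply/rowP => k; rewrite !mxE.
by case: insubP => [k' _ _|_]; rewrite ?mxE ?subrr.
Qed.

Lemma thresholdB a x x' : threshold a (x - x') = threshold a x - threshold a x'.
Proof.
by rewrite /threshold -sumrB; apply: eq_bigr => j _; rewrite !mxE mulrBr.
Qed.

Lemma threshold_continuous a : continuous (threshold a).
Proof.
apply: continuous_big => [|j _ x]; first exact: add_continuous.
have /(_ x) cj : continuous (fun x : 'rV[R]_q => x 0 (rev_ord j)).
  exact: coord_continuous.
exact: (@cvgMl_tmp _ _ (nbhs x)).
Qed.

End shift_register.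

Section transfer_operator.
Variables (R : realType) (q : nat) (mu : probability (measurableTypeR R) R).
Implicit Types (g : 'rV[R]_q -> R) (h : 'rV[R]_q -> R -> R).

Definition transfer h g (x : 'rV[R]_q) : R :=
  \int[mu]_y (h x y * g (push_right x y)).

(** Covers both [K] and [L]. Continuity in x is asked for almost every y only, because a survival
    indicator jumps where y is minus the threshold. *)
Definition transition_weight h : Prop :=
  [/\ forall x y, 0 <= h x y <= 1, forall x, measurable_fun setT (h x) &
      forall x, {ae mu, forall y, {for x, continuous (h^~ y)}}].

Variable h : 'rV[R]_q -> R -> R.
Hypothesis hP : transition_weight h.

Lemma transfer_integrand_measurable g x : continuous g ->
  measurable_fun setT (fun y => h x y * g (push_right x y)).
Proof.
move=> cg; apply: measurable_funM; first by case: hP.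
apply: continuous_measurable_fun => y.
by apply: continuous_comp; [exact: push_right_continuousr|exact: cg].
Qed.

Lemma normr_weightM (r : R) x y : `|h x y * r| <= `|r|.
Proof.
have [h01 _ _] := hP; have /andP[h0 h1] := h01 x y.
by rewrite normrM (ger0_norm h0) ler_piMl.
Qed.

Lemma transfer_integrable g x : bounded_continuous g ->
  mu.-integrable setT (EFin \o (fun y => h x y * g (push_right x y))).
Proof.
move=> /bounded_continuousP[cg [M gM]]; apply: (@bounded_integrable _ _ _ M).
  exact: transfer_integrand_measurable.
by move=> y; apply: le_trans (normr_weightM _ _ _) _.
Qed.

Lemma transfer_bounded g M : continuous g -> (forall x, `|g x| <= M) ->
  forall x, `|transfer h g x| <= M.
Proof.
move=> cg gM x; apply: bounded_Rintegral => [|y].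
  exact: transfer_integrand_measurable.
by apply: le_trans (normr_weightM _ _ _) _.
Qed.

Lemma transfer_bounded_continuous g :
  bounded_continuous g -> bounded_continuous (transfer h g).
Proof.
move=> /bounded_continuousP[cg [M gM]]; apply/bounded_continuousP; split.
  move=> x; apply: (@continuous_Rintegral _ _ _ _ M) => [u|u y|].
  - exact: transfer_integrand_measurable.
  - by apply: le_trans (normr_weightM _ _ _) _.
  - case: hP => _ _ /(_ x); apply: filterS.
      exact: (ae_filter_ringOfSetsType mu).
    move=> y hy; apply: (@cvgM _ _ (nbhs x)); first exact: hy.
    by apply: continuous_comp; [exact: push_right_continuousl|exact: cg].
by exists M; exact: transfer_bounded.
Qed.

Lemma iter_transfer_bounded_continuous n g :
  bounded_continuous g -> bounded_continuous (iter n (transfer h) g).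
Proof. by move=> bg; elim: n => //= n; exact: transfer_bounded_continuous. Qed.

Lemma iter_transfer_bounded n g M : bounded_continuous g ->
  (forall x, `|g x| <= M) -> forall x, `|iter n (transfer h) g x| <= M.
Proof.
move=> bg gM; elim: n => //= n IH x; apply: transfer_bounded => //.
by have [] := iter_transfer_bounded_continuous n bg.
Qed.

Lemma le_transfer g1 g2 : bounded_continuous g1 -> bounded_continuous g2 ->
  (forall x, g1 x <= g2 x) -> forall x, transfer h g1 x <= transfer h g2 x.
Proof.
move=> b1 b2 g12 x; apply: le_Rintegral => //; try exact: transfer_integrable.
by move=> y _; case: hP => h01 _ _; apply: ler_wpM2l; case/andP: (h01 x y).
Qed.

Lemma transferZ c g x : bounded_continuous g ->
  transfer h (fun x => c * g x) x = c * transfer h g x.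
Proof.
move=> bg; rewrite /transfer -RintegralZl//; last exact: transfer_integrable.
by under eq_Rintegral do rewrite mulrCA.
Qed.

Lemma transferD g1 g2 x : bounded_continuous g1 -> bounded_continuous g2 ->
  transfer h (fun x => g1 x + g2 x) x = transfer h g1 x + transfer h g2 x.
Proof.
move=> b1 b2; rewrite /transfer -RintegralD//; try exact: transfer_integrable.
by under eq_Rintegral do rewrite mulrDr.
Qed.

Lemma transferB g1 g2 x : bounded_continuous g1 -> bounded_continuous g2 ->
  transfer h (fun x => g1 x - g2 x) x = transfer h g1 x - transfer h g2 x.
Proof.
move=> b1 b2; rewrite /transfer -RintegralB//; try exact: transfer_integrable.
by under eq_Rintegral do rewrite mulrBr.
Qed.

Lemma transfer_ge0 g : (forall x, 0 <= g x) -> forall x, 0 <= transfer h g x.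
Proof.
move=> g0 x; apply: Rintegral_ge0 => y _.
by case: hP => h01 _ _; apply: mulr_ge0 => //; case/andP: (h01 x y).
Qed.

Lemma iter_transfer_ge0 n g : (forall x, 0 <= g x) ->
  forall x, 0 <= iter n (transfer h) g x.
Proof. by move=> g0; elim: n => //= n; exact: transfer_ge0. Qed.

Lemma le_iter_transfer n g1 g2 : bounded_continuous g1 -> bounded_continuous g2 ->
  (forall x, g1 x <= g2 x) ->
  forall x, iter n (transfer h) g1 x <= iter n (transfer h) g2 x.
Proof.
move=> b1 b2 g12; elim: n => //= n IH.
by apply: le_transfer => //; exact: iter_transfer_bounded_continuous.
Qed.

Lemma iter_transferZ n c g : bounded_continuous g ->
  iter n (transfer h) (fun x => c * g x) = fun x => c * iter n (transfer h) g x.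
Proof.
move=> bg; elim: n => //= n ->; apply/funext => x.
by rewrite transferZ//; exact: iter_transfer_bounded_continuous.
Qed.

End transfer_operator.

Section bounded_continuous_closure.
Variables (R : realType) (q : nat).
Implicit Types g : 'rV[R]_q -> R.

Lemma bounded_continuous_cst (c : R) : bounded_continuous (fun _ : 'rV[R]_q => c).
Proof.
apply/bounded_continuousP; split; first exact: cst_continuous.
by exists `|c|.
Qed.

Lemma bounded_continuousZ c g : bounded_continuous g ->
  bounded_continuous (fun x => c * g x).
Proof.
move=> /bounded_continuousP[cg [M gM]]; apply/bounded_continuousP; split.
  by move=> x; apply: (@cvgMl_tmp _ _ (nbhs x)); apply: cg.
by exists (`|c| * M) => x; rewrite normrM ler_wpM2l.
Qed.

Lemma bounded_continuousD g1 g2 : bounded_continuous g1 ->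
  bounded_continuous g2 -> bounded_continuous (fun x => g1 x + g2 x).
Proof.
move=> /bounded_continuousP[c1 [M1 g1M]] /bounded_continuousP[c2 [M2 g2M]].
apply/bounded_continuousP; split.
  by move=> x; apply: (@cvgD _ _ _ (nbhs x)); [exact: c1|exact: c2].
by exists (M1 + M2) => x; rewrite (le_trans (ler_normD _ _))// lerD.
Qed.

Lemma bounded_continuousB g1 g2 : bounded_continuous g1 ->
  bounded_continuous g2 -> bounded_continuous (fun x => g1 x - g2 x).
Proof.
move=> b1 /(bounded_continuousZ (-1)) b2.
have -> : (fun x => g1 x - g2 x) = (fun x => g1 x + -1 * g2 x).
  by apply/funext => x; rewrite mulN1r.
exact: bounded_continuousD.
Qed.

Lemma bounded_continuous_sum (I : Type) (r : seq I) (f : I -> 'rV[R]_q -> R) :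
  (forall i, bounded_continuous (f i)) ->
  bounded_continuous (fun x => \sum_(i <- r) f i x).
Proof.
move=> bf; elim: r => [|i r IH].
  by under eq_fun do rewrite big_nil; exact: bounded_continuous_cst.
by under eq_fun do rewrite big_cons; exact: bounded_continuousD.
Qed.

End bounded_continuous_closure.

(** * Compactness estimate for the survival kernel *)

Lemma near_eq_continuous_at (V : topologicalType) (W : topologicalType)
    (f : V -> W) (x : V) :
  (\forall u \near x, f u = f x) -> {for x, continuous f}.
Proof. exact: (@cvg_near_cst _ _ _ _ (nbhs x)). Qed.

Lemma integrable_EFinB (R : realType) (d : measure_display)
    (T : measurableType d) (mu : {measure set T -> \bar R}) (D : set T)
    (f g : T -> R) : measurable D -> mu.-integrable D (EFin \o f) ->
  mu.-integrable D (EFin \o g) ->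
  mu.-integrable D (EFin \o (fun y => f y - g y)).
Proof.
by move=> mD fi gi; apply: eq_integrable (integrableB mD fi gi).
Qed.

Section Rintegral_sum.
Variables (R : realType) (d : measure_display) (T : measurableType d).
Variables (mu : {measure set T -> \bar R}) (D : set T) (mD : measurable D).
Variables (I : Type) (f : I -> T -> R).
Hypothesis fint : forall i, mu.-integrable D (EFin \o f i).

Lemma integrable_sum_EFin (s : seq I) :
  mu.-integrable D (EFin \o (fun y => \sum_(i <- s) f i y)).
Proof.
elim: s => [|i s IH].
  under [X in _ \o X]eq_fun do rewrite big_nil.
  exact: integrable0.
under [X in _ \o X]eq_fun do rewrite big_cons.
exact: integrableD (fint i) IH.
Qed.

Lemma Rintegral_sum (s : seq I) :
  \int[mu]_(y in D) (\sum_(i <- s) f i y) =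
  \sum_(i <- s) \int[mu]_(y in D) f i y.
Proof.
elim: s => [|i s IH].
  under eq_Rintegral do rewrite big_nil.
  by rewrite big_nil /Rintegral integral0.
under eq_Rintegral do rewrite big_cons.
by rewrite big_cons RintegralD// ?IH//; exact: integrable_sum_EFin.
Qed.

End Rintegral_sum.

Section survival.
Variables (R : realType) (q : nat) (mu : probability (measurableTypeR R) R).
Variable a : 'rV[R]_q.
Hypothesis mu_atomless : forall r, mu [set r] = 0%E.
Implicit Types (g : 'rV[R]_q -> R) (x : 'rV[R]_q).

Definition survive x (y : R) : R := (0 < y + threshold a x)%R%:R.

Local Notation K := (transfer mu survive).
Local Notation L := (transfer mu (fun=> cst 1)).
Local Notation bc_cst := (bounded_continuous_cst q).

Lemma normr_survive x y : `|survive x y| <= 1.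
Proof. by rewrite /survive normr_nat; case: (0 < _). Qed.

Lemma survive_measurable x : measurable_fun setT (survive x).
Proof.
rewrite /survive.
apply: (@measurableT_comp _ _ _ _ _ _ (fun b : bool => b%:R : R)) => //.
by apply: measurable_fun_ltr => //; apply: measurable_funD.
Qed.

(** Away from y = - threshold, the sign of y + threshold is strict and persists near x, so the
    indicator is locally constant there; the excluded point is null. *)
Lemma survive_weight : transition_weight mu survive.
Proof.
split=> [x y|x|x]; first by rewrite /survive ler0n lern1 leq_b1.
  exact: survive_measurable.
exists [set - threshold a x]; split; [by []|by apply: mu_atomless|].
move=> y /= ncont; apply/eqP; rewrite -subr_eq0 opprK; apply: contra_notT ncont.
move=> yx0; have cyx : continuous (fun u : 'rV[R]_q => y + threshold a u).
  by move=> u; apply: (@cvgD _ _ _ (nbhs u));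
    [exact: cst_continuous|exact: threshold_continuous].
have [yx|yx] := ltP 0 (y + threshold a x).
  have /(@cvgr_gt _ _ (nbhs x))/(_ _ yx) P := cyx x.
  apply: near_eq_continuous_at.
  by apply: filterS P => u; rewrite /survive yx => ->.
have {}yx : y + threshold a x < 0 by rewrite lt_neqAle yx0.
have /(@cvgr_lt _ _ (nbhs x))/(_ _ yx) P := cyx x.
apply: near_eq_continuous_at.
by apply: filterS P => u ux; rewrite /survive !ltNge (ltW ux) (ltW yx).
Qed.

Lemma cst1_weight : transition_weight mu (fun=> cst 1 : R -> R) (q := q).
Proof.
split=> [x y|x|x]; first by rewrite /= ler01 lexx.
  exact: measurable_cst.
by apply: aeW => y; exact: cst_continuous.
Qed.

Lemma transfer1E g x : L g x = \int[mu]_y g (push_right x y).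
Proof. by apply: eq_Rintegral => y _; rewrite mul1r. Qed.

Lemma le_survive_transfer1 g : bounded_continuous g -> (forall x, 0 <= g x) ->
  forall x, K g x <= L g x.
Proof.
move=> bg g0 x; apply: le_Rintegral => //.
- exact: transfer_integrable survive_weight _ _ bg.
- exact: transfer_integrable cst1_weight _ _ bg.
- move=> y _ /=; apply: ler_wpM2r => //.
  by apply: le_trans (normr_survive x y); exact: ler_norm.
Qed.

Lemma le_iter_survive_transfer1 m g : bounded_continuous g ->
  (forall x, 0 <= g x) -> forall x, iter m K g x <= iter m L g x.
Proof.
move=> bg g0; elim: m => //= m IH x.
apply: le_trans (_ : K (iter m L g) x <= _).
  apply: (le_transfer survive_weight) => //;
    apply: iter_transfer_bounded_continuous bg.
  - exact: survive_weight.
  - exact: cst1_weight.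
apply: le_survive_transfer1.
- by apply: iter_transfer_bounded_continuous bg; exact: cst1_weight.
- exact: iter_transfer_ge0 cst1_weight _ _ g0.
Qed.

(** Without the indicator the state is only read after m pushes, and by then its first m coordinates
    have been discarded. *)
Lemma iter_transfer1_forget m g x x' :
  (forall k : 'I_q, (m <= k)%N -> x 0 k = x' 0 k) ->
  iter m L g x = iter m L g x'.
Proof.
elim: m x x' => [|m IH] x x' xx'.
  by congr g; apply/rowP => k; exact: xx'.
rewrite /= !transfer1E; apply: eq_Rintegral => y _.
exact/IH/push_right_coord_eq.
Qed.

Lemma iter_transfer1_cst m g x x' : (q <= m)%N ->
  iter m L g x = iter m L g x'.
Proof.
move=> qm; apply: iter_transfer1_forget => k /(leq_trans qm).
by rewrite leqNgt ltn_ord.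
Qed.

(** Pushes and thresholds are linear in the state, so after the same j innovations the two
    thresholds differ by exactly the quantity in the hypothesis. The copy with the larger threshold
    survives the next step whenever the other does. *)
Lemma iter_transfer1_mono j x x' :
  0 <= threshold a (iter j (fun z => push_right z 0) (x' - x)) ->
  iter j L (K (cst 1)) x <= iter j L (K (cst 1)) x'.
Proof.
elim: j x x' => [|j IH] x x'.
  rewrite /= thresholdB subr_ge0 => xx'; apply: le_Rintegral => //.
  - exact: transfer_integrable survive_weight _ _ (bc_cst 1).
  - exact: transfer_integrable survive_weight _ _ (bc_cst 1).
  - move=> y _ /=; rewrite !mulr1 /survive ler_nat.
    have [yx|//] := ltP 0 (y + threshold a x).
    by rewrite (lt_le_trans yx)// lerD2l.
rewrite [X in threshold a X]iterSr => xx'.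
apply: (le_Rintegral measurableT).
- apply: (transfer_integrable cst1_weight).
  apply: (iter_transfer_bounded_continuous cst1_weight).
  exact: transfer_bounded_continuous survive_weight _ (bc_cst 1).
- apply: (transfer_integrable cst1_weight).
  apply: (iter_transfer_bounded_continuous cst1_weight).
  exact: transfer_bounded_continuous survive_weight _ (bc_cst 1).
- by move=> y _ /=; rewrite !mul1r; apply: IH; rewrite push_rightB.
Qed.

Let bc_LK j : bounded_continuous (iter j L (K (cst 1))).
Proof.
apply: (iter_transfer_bounded_continuous cst1_weight).
exact: transfer_bounded_continuous survive_weight _ (bc_cst 1).
Qed.

Let push_integrable g x : bounded_continuous g ->
  mu.-integrable setT (EFin \o (fun y => g (push_right x y))).
Proof.
move=> /(transfer_integrable cst1_weight x).
by under [X in _ \o X]eq_fun do rewrite mul1r.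
Qed.

(* The increment of the threshold caused by pushing the same values on [x] and
   [x'] does not depend on these values, so the integrand has constant sign. *)
Lemma Rintegral_dist_push j x x' :
  \int[mu]_y `|iter j L (K (cst 1)) (push_right x y)
             - iter j L (K (cst 1)) (push_right x' y)| =
  `|iter j.+1 L (K (cst 1)) x - iter j.+1 L (K (cst 1)) x'|.
Proof.
wlog xx' : x x' / 0 <= threshold a (iter j (fun z => push_right z 0)
    (push_right (x' - x) 0)).
  move=> wl; pose t u u' := threshold a (iter j (fun z => push_right z 0)
    (push_right (u' - u) 0)).
  have [|tn] := leP 0 (t x x'); first exact: wl.
  rewrite distrC -wl; first by apply: eq_Rintegral => y _; rewrite distrC.
  have iterB i u u' : iter i (fun z => push_right z 0) u
     - iter i (fun z => push_right z 0) u'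
     = iter i (fun z => push_right z 0) (u - u') :> 'rV[R]_q.
    by elim: i => //= i IH; rewrite push_rightB IH.
  have := tn; rewrite /t -!iterSr -!iterB !thresholdB.
  by rewrite subr_lt0 subr_ge0 => /ltW.
have le_push y : iter j L (K (cst 1)) (push_right x y) <=
                 iter j L (K (cst 1)) (push_right x' y).
  by apply: iter_transfer1_mono; rewrite push_rightB.
have leS : iter j.+1 L (K (cst 1)) x <= iter j.+1 L (K (cst 1)) x'.
  by apply: iter_transfer1_mono; rewrite iterSr.
rewrite distrC ger0_norm ?subr_ge0// !iterS !transfer1E.
rewrite -RintegralB//; try exact: push_integrable.
by apply: eq_Rintegral => y _; rewrite distrC ger0_norm// subr_ge0.
Qed.

(** The two survival events are half-lines, hence nested, and the difference of their indicators has
    a constant sign. *)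
Lemma Rintegral_dist_survive x x' :
  \int[mu]_y `|survive x y - survive x' y| = `|K (cst 1) x - K (cst 1) x'|.
Proof.
wlog xx' : x x' / threshold a x <= threshold a x'.
  move=> wl; have [|/ltW xx'] := leP (threshold a x) (threshold a x').
    exact: wl.
  by rewrite distrC -wl//; apply: eq_Rintegral => y _; rewrite distrC.
have le_survive y : survive x y <= survive x' y.
  rewrite /survive ler_nat; have [yx|//] := ltP 0 (y + threshold a x).
  by rewrite (lt_le_trans yx)// lerD2l.
have KE u : K (cst 1) u = \int[mu]_y survive u y.
  by apply: eq_Rintegral => y _; rewrite mulr1.
have isv u : mu.-integrable setT (EFin \o survive u).
  apply: (@bounded_integrable _ _ _ 1); first exact: survive_measurable.
  exact: normr_survive.
rewrite distrC !KE -RintegralB// ger0_norm.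
  by apply: eq_Rintegral => y _; rewrite distrC ger0_norm// subr_ge0.
by apply: Rintegral_ge0 => y _; rewrite subr_ge0.
Qed.

Lemma survive_step g M x x' : bounded_continuous g -> (forall x, `|g x| <= M) ->
  `|K g x - K g x'| <= M * `|K (cst 1) x - K (cst 1) x'| +
     \int[mu]_y `|g (push_right x y) - g (push_right x' y)|.
Proof.
move=> bg gM; have [cg _] := bg.
have iK u : mu.-integrable setT (EFin \o (fun y => survive u y * g (push_right u y))).
  exact: transfer_integrable survive_weight _ _ bg.
have mg u : measurable_fun setT (fun y => g (push_right u y)).
  apply: continuous_measurable_fun => y.
  by apply: continuous_comp; [exact: push_right_continuousr|exact: cg].
have ms := survive_measurable.
have i1 : mu.-integrable setT (EFin \o (fun y => `|survive x y - survive x' y|)).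
  apply: (@bounded_integrable _ _ _ 2) => [|y].
    by apply: measurableT_comp => //; apply: measurable_funB.
  rewrite normr_id (le_trans (ler_normB _ _))//.
  by have := lerD (normr_survive x y) (normr_survive x' y); rewrite -natr1 natr1.
have i1M : mu.-integrable setT (EFin \o (fun y => M * `|survive x y - survive x' y|)).
  exact: (integrableZl measurableT M i1).
have i2 : mu.-integrable setT
    (EFin \o (fun y => `|g (push_right x y) - g (push_right x' y)|)).
  apply: (@bounded_integrable _ _ _ (M + M)) => [|y].
    by apply: measurableT_comp => //; apply: measurable_funB.
  by rewrite normr_id (le_trans (ler_normB _ _))// lerD.
rewrite -Rintegral_dist_survive -RintegralZl// -RintegralD//.
rewrite /transfer -RintegralB//.
apply: (le_trans (le_normr_Rintegral _ _)) => //.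
  exact: integrable_EFinB measurableT (iK x) (iK x').
apply: le_Rintegral => //.
- apply: integrable_norm; exact: integrable_EFinB measurableT (iK x) (iK x').
- by apply: eq_integrable (integrableD measurableT i1M i2).
move=> y _.
(* Either one copy dies alone, which costs at most [M], or the discrepancy of [g] is carried on to
   the pushed states. *)
have -> : survive x y * g (push_right x y) - survive x' y * g (push_right x' y) =
  (survive x y - survive x' y) * g (push_right x y)
  + survive x' y * (g (push_right x y) - g (push_right x' y)) by ring.
apply: (le_trans (ler_normD _ _)); rewrite lerD//.
  by rewrite normrM mulrC ler_wpM2r.
exact: normr_weightM survive_weight _ _ _.
Qed.

(** The agreement hypothesis drives the induction: each push removes one coordinate where the states
    may differ, and at m = 0 they are equal. At m = q it is vacuous, which gives the estimate for
    all pairs of states. *)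
Lemma iter_survive_dist m g M x x' : bounded_continuous g ->
  (forall x, `|g x| <= M) ->
  (forall k : 'I_q, (m <= k)%N -> x 0 k = x' 0 k) ->
  `|iter m K g x - iter m K g x'| <=
  M * \sum_(j < m) `|iter j L (K (cst 1)) x - iter j L (K (cst 1)) x'|.
Proof.
move=> bg gM; elim: m x x' => [|m IH] x x' xx'.
  have -> : x = x' by apply/rowP => k; exact: xx'.
  by rewrite subrr normr0 big_ord0 mulr0.
rewrite /=; apply: (le_trans (@survive_step _ M _ _ _ _)).
- exact: iter_transfer_bounded_continuous survive_weight _ _ bg.
- exact: iter_transfer_bounded survive_weight _ _ _ bg gM.
(* The term j = 0 is the disagreement at the first step; the later terms are the sum for the pushed
   states, integrated over the innovation. *)
rewrite big_ord_recl mulrDr lerD2l.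
have dLK (j : nat) : mu.-integrable setT (EFin \o (fun y =>
    `|iter j L (K (cst 1)) (push_right x y) - iter j L (K (cst 1)) (push_right x' y)|)).
  apply: integrable_norm; apply: (integrable_EFinB measurableT);
    exact: push_integrable.
have -> : \sum_(i < m) `|iter (lift ord0 i) L (K (cst 1)) x
     - iter (lift ord0 i) L (K (cst 1)) x'| =
  \int[mu]_y \sum_(j < m) `|iter j L (K (cst 1)) (push_right x y)
     - iter j L (K (cst 1)) (push_right x' y)|.
  rewrite Rintegral_sum//; apply: eq_bigr => j _.
  by rewrite Rintegral_dist_push.
have idx := integrable_sum_EFin measurableT (fun j : 'I_m => dLK j)
  (index_enum _).
rewrite -RintegralZl//.
apply: le_Rintegral => //.
- apply: integrable_norm; apply: (integrable_EFinB measurableT);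
    apply: push_integrable;
    exact: iter_transfer_bounded_continuous survive_weight _ _ bg.
- exact: (integrableZl measurableT M idx).
by move=> y _; apply: IH; exact: push_right_coord_eq.
Qed.

End survival.

(** * Growth rate and eigenfunction *)

Lemma exprn_unbounded (R : realType) (r C : R) : 1 < r -> exists n, C < r ^+ n.
Proof.
move=> r1; have [C1|C0] := ltP C 1; first by exists 0; rewrite expr0.
have /(cvg_geometric 1) : `|r^-1| < 1.
  by rewrite ger0_norm ?invr_ge0 ?(le_trans _ (ltW r1))// invf_lt1// (lt_trans _ r1).
have C'0 : 0 < C^-1 by rewrite invr_gt0 (lt_le_trans _ C0).
move=> /cvgrPdist_lt /(_ _ C'0) [n _ /(_ n (leqnn n)) rn]; exists n; move: rn.
have rn0 : 0 < r ^+ n by rewrite exprn_gt0// (lt_trans _ r1).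
rewrite /= sub0r normrN mul1r exprVn ger0_norm ?invr_ge0 ?(ltW rn0)//.
by rewrite ltf_pV2 ?posrE// (lt_le_trans _ C0).
Qed.

Section growth_rate.
Variables (R : realType) (q : nat) (mu : probability (measurableTypeR R) R).
Variable h : 'rV[R]_q -> R -> R.
Hypothesis hP : transition_weight mu h.
Implicit Types (g : 'rV[R]_q -> R) (x : 'rV[R]_q).
Local Notation K := (transfer mu h).
Local Notation bc_cst := (bounded_continuous_cst q).

Definition mass n : 'rV[R]_q -> R := iter n K (cst 1).

Lemma mass_bounded_continuous n : bounded_continuous (mass n).
Proof. exact: iter_transfer_bounded_continuous hP _ _ (bc_cst 1). Qed.

Lemma mass_ge0 n x : 0 <= mass n x.
Proof. by apply: (iter_transfer_ge0 hP) => z; exact: ler01. Qed.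

Lemma mass_le1 n x : mass n x <= 1.
Proof.
apply: le_trans (ler_norm _) _.
by apply: (iter_transfer_bounded hP) => [|z]; [exact: bc_cst|rewrite normr1].
Qed.

Lemma le_iter_mass n g M : bounded_continuous g -> (forall x, g x <= M) ->
  forall x, iter n K g x <= M * mass n x.
Proof.
move=> bg gM x.
have -> : M * mass n x = iter n K (fun z => M * cst 1 z) x.
  by rewrite (iter_transferZ hP)//; exact: bc_cst.
apply: (le_iter_transfer hP) => //; last by move=> z; rewrite mulr1.
by apply: bounded_continuousZ; exact: bc_cst.
Qed.

Lemma massD m n c x : (forall x, mass n x <= c) -> mass (m + n) x <= c * mass m x.
Proof.
move=> nc; rewrite /mass iterD; apply: le_iter_mass => //.
exact: mass_bounded_continuous.
Qed.

(** As [K] is positive, the norm of [K^n] is the supremum of [K^n 1], so the infimum of these bounds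
    is the spectral radius. Taking geometric bounds instead of n-th roots avoids proving that a
    limit exists. *)
Definition growth_bounds : set R :=
  [set l | 0 < l /\ exists C, forall n x, mass n x <= C * l ^+ n].

Definition growth_rate : R := inf growth_bounds.

Let growth_bounds1 : growth_bounds 1.
Proof.
by split=> //; exists 1 => n x; rewrite expr1n mulr1; exact: mass_le1.
Qed.

Let has_inf_growth_bounds : has_inf growth_bounds.
Proof. by split; [exists 1|exists 0 => l [/ltW]]. Qed.

Lemma growth_rate_ge0 : 0 <= growth_rate.
Proof. by apply: lb_le_inf => [|l [/ltW]]; first by exists 1. Qed.

Lemma growth_rate_le1 : growth_rate <= 1.
Proof. by apply: ge_inf => //; case: has_inf_growth_bounds. Qed.

Lemma mass_ub l : growth_rate < l ->
  exists2 C, 0 < C & forall n x, mass n x <= C * l ^+ n.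
Proof.
move=> gl; have gl0 : 0 < l - growth_rate by rewrite subr_gt0.
have [l' [l'0 [C Cl']]] := inf_adherent gl0 has_inf_growth_bounds.
rewrite -/growth_rate subrKC => l'l.
have C0 : 0 < C by have := Cl' 0 0; rewrite expr0 mulr1; exact: lt_le_trans.
exists C => // n x; apply: le_trans (Cl' n x) _.
by rewrite ler_pM2l// lerXn2r// ?nnegrE ltW// (lt_trans l'0).
Qed.

Let growth_rate_le_root n c : (0 < n)%N -> 0 < c <= 1 ->
  (forall x, mass n x <= c) -> growth_rate ^+ n <= c.
Proof.
move=> n0 /andP[c0 c1] nc; pose l := c `^ n%:R^-1.
have ln : l ^+ n = c.
  rewrite -powR_mulrn ?powR_ge0// -powRrM mulVf ?powRr1 ?(ltW c0)//.
  by rewrite pnatr_eq0 -lt0n.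
have l0 : 0 < l by rewrite powR_gt0.
have l1 : l <= 1.
  by rewrite -(@ler_pXn2r _ n) ?nnegrE ?(ltW l0)// ln expr1n.
rewrite -ln lerXn2r ?nnegrE ?growth_rate_ge0 ?(ltW l0)//.
apply: ge_inf; first by case: has_inf_growth_bounds.
(* Divide m by n with remainder r < n: the quotient gives powers of c = [l ^+ n], and the remainder
   loses at most a factor [l ^- n] since l <= 1. *)
split=> //; exists (l ^- n) => m x.
have massk k : forall r z, mass (r + k * n) z <= c ^+ k.
  elim: k => [|k IH] r z; first by rewrite mul0n addn0 expr0 mass_le1.
  rewrite mulSn addnA addnAC exprS; apply: (le_trans (massD _ _ nc)).
  by rewrite ler_pM2l.
rewrite {1}(divn_eq m n) addnC; apply: (le_trans (massk _ _ _)).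
rewrite -ln -exprM mulnC {2}(divn_eq m n) exprD mulrCA ler_peMr ?exprn_ge0 ?(ltW l0)//.
rewrite mulrC ler_pdivlMr ?exprn_gt0// mul1r.
by rewrite ler_wiXn2l ?(ltW l0)// ltnW// ltn_pmod.
Qed.

Lemma growth_rate_exp_le n c : (0 < n)%N -> (forall x, mass n x <= c) ->
  growth_rate ^+ n <= c.
Proof.
move=> n0 nc; rewrite leNgt; apply/negP => cg.
have c0 : 0 <= c := le_trans (mass_ge0 n 0) (nc 0).
(* The root argument wants a positive bound, while c may be 0; the midpoint of c and beta^n is
   positive and still contradicts the rate. *)
have [c1 c2] := (midf_lt cg).
suff : growth_rate ^+ n <= (c + growth_rate ^+ n) / 2 by rewrite leNgt c2.
apply: growth_rate_le_root => // [|x]; last exact: le_trans (nc x) (ltW c1).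
rewrite (le_lt_trans c0 c1) (le_trans (ltW c2))//.
by rewrite exprn_ile1 ?growth_rate_ge0 ?growth_rate_le1.
Qed.

Lemma lt_growth_rate_exp n c : c < growth_rate ^+ n -> exists x, c < mass n x.
Proof.
case: n => [|n] cg; first by exists 0; move: cg; rewrite expr0.
apply: contrapT => /forallNP nc; move: cg; apply/negP; rewrite -leNgt.
by apply: growth_rate_exp_le => // x; rewrite leNgt; apply/negP/nc.
Qed.

Lemma growth_rate_lt1 n c : (0 < n)%N -> c < 1 -> (forall x, mass n x <= c) ->
  growth_rate < 1.
Proof.
move=> n0 c1 nc; rewrite ltNge; apply/negP => /(exprn_ege1 n).
by rewrite leNgt (le_lt_trans (growth_rate_exp_le n0 nc)).
Qed.

Lemma iter_eigenfunction n l g : bounded_continuous g ->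
  (forall x, K g x = l * g x) -> forall x, iter n K g x = l ^+ n * g x.
Proof.
move=> bg Kg; elim: n => [|n IH] x; first by rewrite expr0 mul1r.
rewrite iterS (_ : iter n K g = fun x => l ^+ n * g x); last exact/funext.
by rewrite (transferZ hP)// Kg mulrA -exprSr.
Qed.

(** With [M] bounding |g|, the iterate [l ^+ n * g x] is at most [M * mass n x] in absolute value,
    hence O(r^n) for some r < l if l exceeded the rate. Signs of [g] do not matter: the bound is
    applied to both g and -g. *)
Lemma eigenvalue_le_growth_rate l : is_eigenvalue K l -> l <= growth_rate.
Proof.
case=> g [bg [x gx0] Kg]; rewrite leNgt; apply/negP => gl.
have [r1 r2] := midf_lt gl; set r := (_ / _) in r1 r2.
have [C C0 massr] := mass_ub r1.
have r0 : 0 < r := le_lt_trans growth_rate_ge0 r1.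
have [_ [M gM]] := (bounded_continuousP _).1 bg.
have M0 : 0 <= M := le_trans (normr_ge0 _) (gM 0).
have lr1 : 1 < l / r by rewrite ltr_pdivlMr// mul1r.
have [n] := exprn_unbounded (M * C / `|g x|) lr1.
rewrite ltr_pdivrMr ?normr_gt0// expr_div_n mulrAC.
rewrite ltr_pdivlMr ?exprn_gt0//; apply/negP; rewrite -leNgt.
have {1}<- : `|l ^+ n| = l ^+ n by rewrite ger0_norm// exprn_ge0// ltW// (lt_trans r0).
rewrite -normrM -(iter_eigenfunction _ bg Kg).
apply: (@le_trans _ _ (M * mass n x)); last by rewrite -mulrA ler_wpM2l.
rewrite ler_norml; apply/andP; split.
  have -> : iter n K g x = - iter n K (fun z => -1 * g z) x.
    by rewrite (iter_transferZ hP)// mulN1r opprK.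
  rewrite lerN2; apply: le_iter_mass => [|z]; first exact: bounded_continuousZ.
  by rewrite mulN1r (le_trans _ (gM z))// -normrN ler_norm.
by apply: le_iter_mass => // z; apply: le_trans (gM z); exact: ler_norm.
Qed.

End growth_rate.

(** * Approximate eigenfunctions from truncated resolvent sums *)

Section resolvent.
Variables (R : realType) (q : nat) (mu : probability (measurableTypeR R) R).
Variable h : 'rV[R]_q -> R -> R.
Hypothesis hP : transition_weight mu h.
Implicit Types (g : 'rV[R]_q -> R) (x : 'rV[R]_q).
Local Notation K := (transfer mu h).
Local Notation mass := (mass mu h).
Local Notation beta := (growth_rate mu h).

Definition resolvent_sum l m x : R := \sum_(n < m) l ^- n * mass n x.

Lemma resolvent_sum_bounded_continuous l m :
  bounded_continuous (resolvent_sum l m).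
Proof.
apply: bounded_continuous_sum => n; apply: bounded_continuousZ.
exact: mass_bounded_continuous.
Qed.

(** [K] shifts the index of each term at the price of a factor l; the shifted sum misses the zeroth
    term, which is 1. *)
Lemma transfer_resolvent_sum l m x : l != 0 ->
  K (resolvent_sum l m) x = l * (resolvent_sum l m.+1 x - 1).
Proof.
move=> l0; elim: m => [|m IH].
  rewrite /resolvent_sum big_ord_recl big_ord0 expr0 invr1 mul1r addr0 subrr mulr0.
  rewrite (_ : (fun _ => _) = (fun z => 0 * cst 1 z)); last first.
    by apply/funext => z; rewrite big_ord0 mul0r.
  by rewrite (transferZ hP) ?mul0r//; exact: bounded_continuous_cst.
rewrite (_ : resolvent_sum l m.+1 =
    fun z => resolvent_sum l m z + l ^- m * mass m z); last first.
  by apply/funext => z; rewrite /resolvent_sum big_ord_recr.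
rewrite (transferD hP) ?IH; last 2 first.
- exact: resolvent_sum_bounded_continuous.
- by apply: bounded_continuousZ; exact: mass_bounded_continuous.
rewrite (transferZ hP); last exact: mass_bounded_continuous.
rewrite [resolvent_sum l m.+2 x]big_ord_recr /= -/(resolvent_sum l m.+1 x).
have -> : l ^- m = l * l ^- m.+1 by rewrite exprS invfM mulrA divff// mul1r.
by rewrite -mulrA -mulrDr addrAC.
Qed.

Lemma le_resolvent_sum l m n x : 0 < l -> (m <= n)%N ->
  resolvent_sum l m x <= resolvent_sum l n x.
Proof.
move=> l0 /subnKC <-; rewrite /resolvent_sum big_split_ord /= lerDl.
apply: sumr_ge0 => i _; rewrite mulr_ge0 ?invr_ge0 ?exprn_ge0 ?(ltW l0)//.
exact: mass_ge0.
Qed.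

(* A bound [C] on the partial sums forces geometric decay of the masses:
   [K S_m = l (S_(m+1) - 1) <= l (1 - 1/C) S_(m+1)]. *)
Lemma mass_decay l C N j x : 0 < l -> 1 <= C ->
  (forall z, resolvent_sum l N z <= C) -> (j < N)%N ->
  mass j x <= l ^+ j * (1 - C^-1) ^+ j * C.
Proof.
move=> l0 C1 SC jN.
have C0 : 0 < C := lt_le_trans ltr01 C1.
have C'1 : 0 <= 1 - C^-1 by rewrite subr_ge0 invf_le1.
have bS m := resolvent_sum_bounded_continuous l m.
have SC' m z : (m <= N)%N -> resolvent_sum l m z <= C.
  by move=> mN; apply: le_trans (SC z); exact: le_resolvent_sum.
have decay i : (i.+1 <= N)%N -> forall z, iter i K (resolvent_sum l 1) z <=
    (l * (1 - C^-1)) ^+ i * resolvent_sum l i.+1 z.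
  elim: i => [_ z|i IH iN z]; first by rewrite expr0 mul1r.
  rewrite iterS.
  apply: (@le_trans _ _ (K (fun z => (l * (1 - C^-1)) ^+ i * resolvent_sum l i.+1 z) z)).
    apply: (le_transfer hP) => //.
    - exact: iter_transfer_bounded_continuous hP _ _ (bS 1).
    - exact: bounded_continuousZ.
    - by apply: IH; exact: ltnW.
  rewrite (transferZ hP)// transfer_resolvent_sum ?gt_eqF//.
  rewrite [in leRHS]exprSr -mulrA ler_wpM2l ?exprn_ge0 ?mulr_ge0 ?(ltW l0)//.
  rewrite -mulrA ler_pM2l// mulrBl mul1r lerB// mulrC ler_pdivrMr// mul1r.
  exact: SC'.
have := decay j jN x.
rewrite (_ : resolvent_sum l 1 = cst 1); last first.
  apply/funext => z; rewrite /resolvent_sum big_ord_recl big_ord0.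
  by rewrite expr0 invr1 mul1r addr0.
move=> /le_trans; apply; rewrite exprMn ler_wpM2l ?SC'//.
by rewrite mulr_ge0 ?exprn_ge0// ltW.
Qed.

Lemma approximate_eigenfunction eps : 0 < beta -> 0 < eps ->
  exists v, [/\ bounded_continuous v, forall x, 0 <= v x <= 1,
    exists x, 2^-1 <= v x & forall x, `|K v x - beta * v x| <= eps].
Proof.
(* Normalizing by a supremum s > 4 / eps makes l / s at most eps / 2 once l < 2; the added 1 ensures
   [C > 1], so that 1 - 1/C is positive. *)
move=> b0 e0; pose C := 4 / eps + 1.
have C1 : 1 < C by rewrite ltrDr divr_gt0.
have C0 : 0 < C := lt_trans ltr01 C1.
have Cinv1 : 0 < 1 - C^-1 by rewrite subr_gt0 invf_lt1.
(* If the sums stayed below [C], [mass j] would be at most l^j (1 - 1/C)^j C. This j makes it less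
   than l^j / 2, and l, chosen after j, makes that less than beta^j: too small for the growth
   rate. *)
have [j jP] : exists j, 2 * C < (1 - C^-1)^-1 ^+ j.
  by apply: exprn_unbounded; rewrite invf_gt1// ltrBlDr ltrDl invr_gt0.
have {}jP : (1 - C^-1) ^+ j * C < 2^-1.
  rewrite -ltr_pdivlMl ?exprn_gt0// -exprVn.
  by rewrite mulrC ltr_pdivlMl.
have [l [bl l2 leps lj]] : exists l, [/\ beta < l, l < 2, l - beta < eps / 2 &
    l ^+ j * 2^-1 < beta ^+ j].
  near beta^'+ => l; exists l; split => //.
  - near: l; apply: nbhs_right_lt.
    by rewrite (le_lt_trans (growth_rate_le1 _))// ltr1n.
  - rewrite ltrBlDl; near: l; apply: nbhs_right_lt.
    by rewrite ltrDl divr_gt0.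
  - near: l; apply: cvg_within.
    have cj : l ^+ j * 2^-1 @[l --> beta] --> beta ^+ j * 2^-1.
      by apply: cvgMr_tmp; exact: exprn_continuous.
    apply: (@cvgr_lt _ _ (nbhs beta) _ _ _ cj).
    by rewrite ltr_pdivrMr// ltr_pMr ?exprn_gt0// ltr1n.
have l0 : 0 < l := lt_trans b0 bl.
(* A rate strictly between beta and l makes [l ^- N * mass N] small, which controls the boundary
   term created by truncation. *)
have [r1 r2] := midf_lt bl; set r := (_ / _) in r1 r2.
have r0 : 0 < r := lt_trans b0 r1.
have [C' C'0 massr] := mass_ub hP r1.
have [N0 N0P] : exists n, C' < (l / r) ^+ n.
  by apply: exprn_unbounded; rewrite ltr_pdivlMr// mul1r.
have lr1 : 1 < l / r by rewrite ltr_pdivlMr// mul1r.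
(* [N0] brings the boundary term below 1; the rest ensures j < N, as [mass_decay] requires. *)
pose N := (N0 + j.+1)%N.
have NP x : 0 <= l ^- N * mass N x <= 1.
  rewrite mulr_ge0 ?mass_ge0 ?invr_ge0 ?exprn_ge0 ?(ltW l0)//=.
  rewrite mulrC ler_pdivrMr ?exprn_gt0// mul1r.
  apply: (le_trans (massr _ _)).
  rewrite -ler_pdivlMr ?exprn_gt0// -expr_div_n.
  rewrite (le_trans (ltW N0P))// ler_weXn2l ?leq_addr// ltW//.
have [x0 Cx0] : exists x, C < resolvent_sum l N x.
  apply: contrapT => /forallNP nC.
  have : l ^+ j * (1 - C^-1) ^+ j * C < beta ^+ j.
    by apply: le_lt_trans lj; rewrite -mulrA ler_pM2l ?exprn_gt0// ltW.
  move=> /(lt_growth_rate_exp hP)[x]; apply/negP; rewrite -leNgt.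
  apply: (@mass_decay _ _ N) => //; [exact: ltW| |].
    by move=> z; rewrite leNgt; apply/negP/nC.
  by rewrite /N addnS ltnS leq_addl.
have bS := resolvent_sum_bounded_continuous l N.
have S0 x : 0 <= resolvent_sum l N x.
  apply: sumr_ge0 => i _; rewrite mulr_ge0 ?invr_ge0 ?exprn_ge0 ?(ltW l0)//.
  exact: mass_ge0.
pose s := sup (range (resolvent_sum l N)).
have has_sup_S : has_sup (range (resolvent_sum l N)).
  split; first by exists (resolvent_sum l N x0), x0.
  have [_ [M SM]] := (bounded_continuousP _).1 bS.
  by exists M => _ [x _ <-]; apply: le_trans (SM x); exact: ler_norm.
have Ss x : resolvent_sum l N x <= s by apply: ub_le_sup; [case: has_sup_S|exists x].
have Cs : C < s := lt_le_trans Cx0 (Ss x0).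
have s0 : 0 < s := lt_trans C0 Cs.
exists (fun x => s^-1 * resolvent_sum l N x); split.
- exact: bounded_continuousZ.
- move=> x; rewrite mulr_ge0 ?invr_ge0 ?(ltW s0)//= mulrC.
  by rewrite ler_pdivrMr// mul1r.
(* The supremum need not be attained, hence the value 1/2 instead of 1. *)
- have [_ [x _ <-]] := sup_adherent (divr_gt0 s0 (ltr0n R 2)) has_sup_S.
  rewrite -/s => sx; exists x; rewrite mulrC ler_pdivlMr// ltW//.
  by apply: le_lt_trans sx; rewrite mulrC; lra.
move=> x; rewrite (transferZ hP)// transfer_resolvent_sum ?gt_eqF//.
have -> : resolvent_sum l N.+1 x = resolvent_sum l N x + l ^- N * mass N x.
  by rewrite /resolvent_sum big_ord_recr.
set S := resolvent_sum l N x; set t := l ^- N * mass N x.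
have -> : s^-1 * (l * (S + t - 1)) - beta * (s^-1 * S) =
  (l - beta) * (s^-1 * S) + l / s * (t - 1) by ring.
have /andP[t0 t1] := NP x; rewrite -/t in t0 t1.
have sS0 : 0 <= s^-1 * S by rewrite mulr_ge0 ?invr_ge0 ?S0// ltW.
have sS1 : s^-1 * S <= 1 by rewrite mulrC ler_pdivrMr// mul1r Ss.
have lb0 : 0 <= l - beta by rewrite subr_ge0 ltW.
apply: (le_trans (ler_normD _ _)); rewrite [leRHS](splitr eps) lerD//.
  rewrite (ger0_norm (mulr_ge0 lb0 sS0)); apply: le_trans (ltW leps).
  by rewrite ler_piMr.
have ls0 : 0 <= l / s := divr_ge0 (ltW l0) (ltW s0).
rewrite normrM (ger0_norm ls0).
apply: (@le_trans _ _ (l / s)).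
  by rewrite ler_piMr// ler_norml; apply/andP; split; lra.
rewrite ler_pdivrMr// (le_trans (ltW l2))//.
have : 4 / eps < s by apply: lt_trans Cs; rewrite ltrDl.
by rewrite ltr_pdivrMr// mulrC => ?; lra.
Unshelve. all: by end_near. Qed.

End resolvent.

(** * Limits along ultrafilters and uniform convergence *)

Lemma ultra_fmap (T S : Type) (f : T -> S) (U : set_system T) :
  UltraFilter U -> UltraFilter (f @ U).
Proof.
move=> UU; split; first exact: fmap_proper_filter.
move=> G GP fG; apply/seteqP; split=> // A GA.
have [//|UnA] := in_ultra_setVsetC (f @^-1` A) UU.
have GnA : G (~` A) by apply: fG; rewrite /fmap /= preimage_setC.
by have [x []] := @filter_ex _ _ GP _ (filterI GA GnA).
Qed.

(** Replaces the extraction of subsequences: one ultrafilter gives limits at all points at once,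
    without a diagonal argument. *)
Lemma ultra_bounded_cvg (R : realType) (T : Type) (U : set_system T)
    (u : T -> R) (b c : R) :
  UltraFilter U -> (forall k, b <= u k <= c) -> exists l : R, u k @[k --> U] --> l.
Proof.
move=> UU ubc; have := @segment_compact R b c; rewrite compact_ultra.
move=> /(_ (u @ U) (ultra_fmap u UU)) [].
  by apply: nearW => k; rewrite /= in_itv; exact: ubc.
by move=> l [_ ul]; exists l.
Qed.

(* Pointwise convergence is uniform since the functions are equi-Lipschitz for
   the totally bounded pseudometric induced by a map into a cube. *)
Lemma cvg_uniform_of_cube (R : realType) (T V : Type) (U : set_system T)
    (q : nat) (w : T -> V -> R) (w_lim : V -> R) (phi : 'I_q -> V -> R) (v0 : V) :
  ProperFilter U -> (forall j x, 0 <= phi j x <= 1) ->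
  (forall k x x', `|w k x - w k x'| <= \sum_(j < q) `|phi j x - phi j x'|) ->
  (forall x, w k x @[k --> U] --> w_lim x) ->
  forall eps, 0 < eps -> \forall k \near U, forall x, `|w k x - w_lim x| <= eps.
Proof.
move=> PU phi01 wphi wl eps eps0.
(* Five comparisons: from [w k x] to [w k r], [w_lim r], [w k' r], [w k' x] and [w_lim x], where r
   represents the bin of x. *)
have [e [e0 epsE]] : exists e, 0 < e /\ eps = 5 * e.
  by exists (eps / 5); split; [rewrite divr_gt0|rewrite mulrC divfK].
pose N := (Num.truncn (q%:R / e)).+1.
have qN : q%:R / N%:R <= e.
  rewrite ler_pdivrMr ?ltr0n// mulrC -ler_pdivrMr//.
  exact: ltW (truncnS_gt _).
(* The cube is cut into cells of side 1/N with q/N <= e. The value 1 of a coordinate has its own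
   index N, hence [N.+1] indices. *)
pose bin x : {ffun 'I_q -> 'I_N.+1} :=
  [ffun j => inord (Num.truncn (N%:R * phi j x))].
have binP x x' : bin x = bin x' -> \sum_(j < q) `|phi j x - phi j x'| <= e.
  move=> bxx'; apply: le_trans qN.
  rewrite [leRHS](_ : _ = \sum_(j < q) N%:R^-1); last first.
    by rewrite sumr_const card_ord -[RHS]mulr_natl.
  apply: ler_sum => j _.
  have le z : (Num.truncn (N%:R * phi j z) < N.+1)%N.
    rewrite ltnS truncn_le_nat -natr1; have /andP[p0 p1] := phi01 j z.
    by rewrite ltr_pwDr// -[leRHS]mulr1 ler_pM2l// ltr0n.
  have := congr1 (fun f : {ffun 'I_q -> 'I_N.+1} => f j : nat) bxx'.
  rewrite !ffunE !inordK// => tt'.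
  have itv z : (Num.truncn (N%:R * phi j z))%:R <= N%:R * phi j z
      < (Num.truncn (N%:R * phi j z)).+1%:R.
    by apply: truncn_itv; rewrite mulr_ge0//; case/andP: (phi01 j z).
  have /andP[l1 r1] := itv x; have /andP[l2 r2] := itv x'.
  rewrite -tt' -natr1 in l2 r2; rewrite -natr1 in r1.
  rewrite -(@ler_pM2l _ N%:R) ?ltr0n// divff ?pnatr_eq0//.
  rewrite -[X in X * `|_|]ger0_norm// -normrM mulrBr.
  by rewrite ler_norml; apply/andP; split; lra.
(* One point per occupied cell; empty cells receive the dummy [v0]. *)
have [rep repP] : exists rep : {ffun 'I_q -> 'I_N.+1} -> V,
    forall x, bin (rep (bin x)) = bin x.
  suff /choice[rep repP] : forall b, exists r, forall x, bin x = b -> bin r = b.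
    by exists rep => x; exact: repP.
  move=> b; have [[r rb]|nb] := pselect (exists r, bin r = b); first by exists r.
  by exists v0 => x xb; exfalso; apply: nb; exists x.
have near_rep : \forall k \near U, forall b, `|w_lim (rep b) - w k (rep b)| <= e.
  apply: filter_forall => b.
  by have /cvgrPdist_le/(_ _ e0) := wl (rep b).
apply: filterS (near_rep) => k kP x.
have near_x : \forall k \near U, `|w_lim x - w k x| <= e.
  by have /cvgrPdist_le/(_ _ e0) := wl x.
(* [k'] depends on x, but it is auxiliary: the condition on k concerns the finitely many
   representatives only, so it is uniform in x. *)
have [k' [k'P k'x]] := filter_ex (filterI near_rep near_x).
set r := rep (bin x).
have d1 : `|w k x - w k r| <= e.
  by apply: (le_trans (wphi _ _ _)); apply: binP; rewrite repP.
have d2 : `|w k' r - w k' x| <= e.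
  by apply: (le_trans (wphi _ _ _)); apply: binP; rewrite repP.
have := kP (bin x); have := k'P (bin x); rewrite -/r => d3 d4.
move: d1 d2 d3 d4 k'x; rewrite !ler_norml.
move=> /andP[? ?] /andP[? ?] /andP[? ?] /andP[? ?] /andP[? ?].
by apply/andP; split; lra.
Qed.

(** * Passage to the limit in the approximate eigenfunctions *)

Section survival_eigenfunction.
Variables (R : realType) (q : nat) (mu : probability (measurableTypeR R) R).
Variable a : 'rV[R]_q.
Hypothesis mu_atomless : forall r, mu [set r] = 0%E.
Implicit Types (g : 'rV[R]_q -> R) (x : 'rV[R]_q).
Local Notation K := (transfer mu (survive a)).
Local Notation L := (transfer mu (fun=> cst 1)).
Local Notation beta := (growth_rate mu (survive a)).
Let hP := survive_weight a mu_atomless.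

(** Each iteration adds at most one eps: [K] does not increase the sup norm, and powers of beta are
    at most 1. *)
Lemma iter_approximate_eigenfunction n v eps : bounded_continuous v ->
  (forall x, `|K v x - beta * v x| <= eps) ->
  forall x, `|iter n K v x - beta ^+ n * v x| <= n%:R * eps.
Proof.
move=> bv ve; elim: n => [|n IH] x; first by rewrite expr0 mul1r subrr normr0 mul0r.
have b0 := growth_rate_ge0 hP.
have bKn := iter_transfer_bounded_continuous hP n bv.
have -> : iter n.+1 K v x - beta ^+ n.+1 * v x =
    (K (iter n K v) x - K (fun z => beta ^+ n * v z) x) +
    beta ^+ n * (K v x - beta * v x).
  by rewrite (transferZ hP)// exprSr iterS; ring.
rewrite -(transferB hP)//; last exact: bounded_continuousZ.
apply: (le_trans (ler_normD _ _)); rewrite -natr1 mulrDl mul1r lerD//.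
  apply: (transfer_bounded hP) => //.
  have : bounded_continuous (fun x => iter n K v x - beta ^+ n * v x).
    by apply: bounded_continuousB => //; exact: bounded_continuousZ.
  by case.
rewrite normrM ger0_norm ?exprn_ge0// -[leRHS]mul1r ler_pM ?exprn_ge0//.
by rewrite exprn_ile1// growth_rate_le1.
Qed.

Lemma eigenfunction_of_approximations psi : 0 < beta ->
  (forall eps, 0 < eps -> exists v, [/\ bounded_continuous v,
    forall x, 0 <= v x, exists x, 2^-1 <= v x,
    forall x, `|K v x - beta * v x| <= eps & forall x, `|v x - psi x| <= eps]) ->
  is_eigenfunction K beta psi /\ forall x, 0 <= psi x.
Proof.
move=> b0 app; have b1 := growth_rate_le1 hP.
have bpsi : bounded_continuous psi.
  apply/bounded_continuousP; split.
    move=> x; apply/(@cvgrPdist_le _ _ _ (nbhs x)) => eps e0.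
    have e30 : 0 < eps / 3 by rewrite divr_gt0.
    have [v [[cv _] _ _ _ vpsi]] := app _ e30.
    have /(@cvgrPdist_le _ _ _ (nbhs x))/(_ _ e30) := cv x; apply: filterS => u.
    have := vpsi x; have := vpsi u; rewrite !ler_norml.
    by move=> /andP[? ?] /andP[? ?] /andP[? ?]; apply/andP; split; lra.
  have [v [/bounded_continuousP[_ [M vM]] _ _ _ vpsi]] := app _ ltr01.
  exists (M + 1) => x; rewrite -[psi x](subKr (v x)).
  by rewrite (le_trans (ler_normB _ _))// lerD.
split; first split=> //.
(* Where v is at least 1/2, an error of 1/4 leaves psi at least 1/4; the normalization of v thus
   prevents a zero limit. *)
- have e0 : 0 < 4^-1 :> R by rewrite invr_gt0.
  have [v [_ _ [x vx] _ vpsi]] := app _ e0; exists x; rewrite gt_eqF//.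
  by move: (vpsi x); rewrite ler_norml => /andP[? ?]; lra.
- move=> x; apply/eqP; rewrite -subr_eq0 -normr_le0.
  apply/ler_addgt0Pl => eps e0; rewrite addr0.
  have e30 : 0 < eps / 3 by rewrite divr_gt0.
  have [v [bv _ _ Kv vpsi]] := app _ e30.
  have K1 : `|K v x - K psi x| <= eps / 3.
    rewrite -(transferB hP)//; apply: (transfer_bounded hP) => //.
    by case: (bounded_continuousB bv bpsi).
  have K3 : `|beta * v x - beta * psi x| <= eps / 3.
    rewrite -mulrBr normrM (gtr0_norm b0) (le_trans _ (vpsi x))//.
    by rewrite ler_piMl.
  have K2 := Kv x; move: K1 K2 K3; rewrite !ler_norml.
  by move=> /andP[? ?] /andP[? ?] /andP[? ?]; apply/andP; split; lra.
- move=> x; apply/ler_addgt0Pl => eps e0.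
  have [v [_ v0 _ _ /(_ x)]] := app _ e0; have := v0 x.
  by rewrite ler_norml => ? /andP[? ?]; lra.
Qed.

Lemma survival_eigenfunction : 0 < beta ->
  exists psi, is_eigenfunction K beta psi /\ forall x, 0 <= psi x.
Proof.
move=> b0.
have /choice[v vP] : forall k : nat, exists v, [/\ bounded_continuous v,
    forall x, 0 <= v x <= 1, exists x, 2^-1 <= v x &
    forall x, `|K v x - beta * v x| <= k.+1%:R^-1].
  by move=> k; apply: (approximate_eigenfunction hP) => //; rewrite invr_gt0.
have [U [UU oU]] := ultraFilterLemma (eventually_filter).
(* The compactness estimate bears on [K^q v_k], not on [v_k]. Since [K^q v_k] is close to beta^q
   [v_k], dividing its limit by beta^q, which is positive, gives a limit of the [v_k] themselves. *)
pose w k := iter q K (v k).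
have w01 k x : 0 <= w k x <= 1.
  have [bv v01 _ _] := vP k.
  have v0 z : 0 <= v k z by case/andP: (v01 z).
  rewrite (iter_transfer_ge0 hP)//=; apply: le_trans (ler_norm _) _.
  by apply: (iter_transfer_bounded hP) => // z; rewrite ger0_norm//; case/andP: (v01 z).
have /choice[w_lim wl] : forall x, exists l : R, w k x @[k --> U] --> l.
  by move=> x; apply: ultra_bounded_cvg => k; exact: w01.
pose phi (j : 'I_q) := iter j L (K (cst 1)).
have phi01 j x : 0 <= phi j x <= 1.
  have K0 z : 0 <= K (cst 1) z by apply: (transfer_ge0 hP) => ?; exact: ler01.
  have bc1 : bounded_continuous (cst 1 : 'rV[R]_q -> R) by exact: bounded_continuous_cst.
  rewrite (iter_transfer_ge0 (cst1_weight q mu))//=; apply: le_trans (ler_norm _) _.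
  apply: (iter_transfer_bounded (cst1_weight q mu)).
    exact: transfer_bounded_continuous.
  by apply: (transfer_bounded hP) => [|z]; [case: bc1|rewrite normr1].
have wphi k x x' : `|w k x - w k x'| <= \sum_(j < q) `|phi j x - phi j x'|.
  have [bv v01 _ _] := vP k.
  rewrite -[leRHS]mul1r; apply: iter_survive_dist => // [z|i].
    by rewrite ger0_norm; case/andP: (v01 z).
  by rewrite leqNgt ltn_ord.
have unif := cvg_uniform_of_cube (0 : 'rV[R]_q) _ phi01 wphi wl.
exists (fun x => beta ^- q * w_lim x).
apply: eigenfunction_of_approximations => // eps e0.
have bq0 : 0 < beta ^+ q by rewrite exprn_gt0.
have e20 : 0 < beta ^+ q * (eps / 2) by rewrite mulr_gt0// divr_gt0.
have Uk := unif _ _ e20.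
have d0 : 0 < beta ^+ q * (eps / 2) / (q%:R + 1).
  by rewrite divr_gt0// ltr_wpDl.
have Uk2 : U [set k | k.+1%:R^-1 <= eps /\ q%:R * k.+1%:R^-1 <= beta ^+ q * (eps / 2)].
  apply: oU; near=> k; split.
    by apply: ltW; near: k; exact: (near_infty_natSinv_lt (PosNum e0)).
  apply: (@le_trans _ _ ((q%:R + 1) * k.+1%:R^-1)).
    by rewrite ler_wpM2r ?invr_ge0// lerDl.
  rewrite mulrC -ler_pdivlMr ?ltr_wpDl//.
  by apply: ltW; near: k; exact: (near_infty_natSinv_lt (PosNum d0)).
have [k [wk [ke qke]]] := filter_ex (filterI (Uk _) Uk2).
have [bv v01 vx Kv] := vP k.
exists (v k); split => // [x|x|x]; first by case/andP: (v01 x).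
  exact: le_trans (Kv x) _.
rewrite -(ler_pM2l bq0) -[X in X * `|_|](gtr0_norm bq0) -normrM mulrBr.
rewrite mulrA divff ?gt_eqF// mul1r.
have d1 := iter_approximate_eigenfunction q bv Kv x.
have d2 := wk x; rewrite -/(w k) in d1.
have {}d1 := le_trans d1 qke.
rewrite [eps in leRHS]splitr mulrDr.
move: d1 d2; rewrite !ler_norml => /andP[? ?] /andP[? ?].
by apply/andP; split; lra.
Unshelve. all: by end_near. Qed.

End survival_eigenfunction.

(** * The chain driven by i.i.d. innovations *)

Section coordinate_measurability.
Variables (R : realType) (q : nat) (mu : probability (measurableTypeR R) R).
Implicit Types (g : 'rV[R]_q -> R) (h : 'rV[R]_q -> R -> R).

Definition measurable_coords d (S : measurableType d) (X : S -> 'rV[R]_q) :=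
  forall j, measurable_fun setT (fun s => X s 0 j).

(* Measurability is tested along maps with measurable coordinates, as ['rV[R]_q]
   carries no sigma-algebra. *)
Definition coord_measurable g :=
  forall d (S : measurableType d) (X : S -> 'rV[R]_q),
  measurable_coords X -> measurable_fun setT (g \o X).

Definition coord_measurable2 h :=
  forall d (S : measurableType d) (X : S -> 'rV[R]_q) (Y : S -> R),
  measurable_coords X -> measurable_fun setT Y ->
  measurable_fun setT (fun s => h (X s) (Y s)).

Lemma measurable_coords_push_right d (S : measurableType d)
    (X : S -> 'rV[R]_q) (Y : S -> R) : measurable_coords X ->
  measurable_fun setT Y -> measurable_coords (fun s => push_right (X s) (Y s)).
Proof.
move=> mX mY j; under eq_fun do rewrite push_rightE.
by case: insubP => [k _ _|_]; [exact: mX|exact: mY].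
Qed.

Lemma threshold_measurable (a : 'rV[R]_q) : coord_measurable (threshold a).
Proof.
move=> d S X mX; rewrite /comp /threshold.
by apply: measurable_sum => j; apply: measurable_funM => //; exact: mX.
Qed.

Lemma survive_measurable2 (a : 'rV[R]_q) : coord_measurable2 (survive a).
Proof.
move=> d S X Y mX mY; rewrite /survive.
apply: (@measurableT_comp _ _ _ _ _ _ (fun b : bool => b%:R : R)) => //.
apply: measurable_fun_ltr => //; apply: measurable_funD => //.
exact: threshold_measurable.
Qed.

(** Composed with X, the operator is a partial integral over the second factor of S times the line,
    so Tonelli's theorem applies. *)
Lemma transfer_coord_measurable h g : transition_weight mu h ->
  coord_measurable2 h -> bounded_continuous g -> (forall x, 0 <= g x) ->
  coord_measurable g -> coord_measurable (transfer mu h g).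
Proof.
move=> hP mh bg g0 mg d S X mX; apply/measurable_EFinP.
pose f (z : S * measurableTypeR R) : \bar R :=
  (h (X z.1) z.2 * g (push_right (X z.1) z.2))%:E.
have mX1 : measurable_coords (fun z : S * measurableTypeR R => X z.1).
  by move=> j; apply: (measurableT_comp (mX j)).
have m2 : measurable_fun setT (fun z : S * measurableTypeR R => z.2 : R).
  exact: measurable_snd.
have mf : measurable_fun setT f.
  apply/measurable_EFinP; apply: measurable_funM; first exact: mh.
  exact: mg (measurable_coords_push_right mX1 m2).
have f0 z : (0 <= f z)%E.
  rewrite lee_fin mulr_ge0//; case: hP => h01 _ _.
  by case/andP: (h01 (X z.1) z.2).
rewrite (_ : _ \o _ = fubini_F mu f).
  exact: measurable_fun_fubini_tonelli_F.
apply/funext => s; rewrite /fubini_F /= /transfer /Rintegral fineK//.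
exact: integrable_fin_num (transfer_integrable hP (X s) bg).
Qed.

Lemma iter_transfer_coord_measurable n h g : transition_weight mu h ->
  coord_measurable2 h -> bounded_continuous g -> (forall x, 0 <= g x) ->
  coord_measurable g -> coord_measurable (iter n (transfer mu h) g).
Proof.
move=> hP mh bg g0 mg; elim: n => //= n IH.
apply: transfer_coord_measurable => //.
- exact: iter_transfer_bounded_continuous.
- exact: (iter_transfer_ge0 hP).
Qed.

End coordinate_measurability.

(** * Independence of the past and the next innovation *)

Section independent_pair.
Variables (R : realType) (d : measure_display) (T : measurableType d).
Variables (P : probability T R) (d' : measure_display) (S : measurableType d').
Variables (V : {mfun T >-> S}) (Y : {mfun T >-> measurableTypeR R}).
Variable mu : probability (measurableTypeR R) R.
Hypothesis VY : forall A B, measurable A -> measurable B ->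
  P (V @^-1` A `&` Y @^-1` B) = (P (V @^-1` A) * mu B)%E.

(** The factorization on rectangles identifies the law of (V, Y) with the product of the law of [V]
    and [mu]; Tonelli then integrates out [Y]. *)
Lemma integral_independent_pair (f : S * measurableTypeR R -> \bar R) :
  measurable_fun setT f -> (forall z, 0 <= f z)%E ->
  (\int[P]_w f (V w, Y w) = \int[P]_w \int[mu]_y f (V w, y))%E.
Proof.
move=> mf f0.
have mVY : measurable_fun setT (fun w => (V w, Y w)).
  by apply: measurable_fun_pair; exact: measurable_funP.
pose VYm : {mfun T >-> (S * measurableTypeR R)%type} :=
  HB.pack (fun w => (V w, Y w)) (isMeasurableFun.Build _ _ _ _ _ mVY).
transitivity (\int[distribution P VYm]_z f z)%E.
  by rewrite ge0_integral_distribution.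
transitivity (\int[(distribution P V \x mu)%E]_z f z)%E.
  idtac.
  apply: eq_measure_integral => A mA _; apply/esym.
  by apply: (@product_measure_unique _ _ _ _ _ (distribution P V) mu
    (distribution P VYm)).
rewrite fubini_tonelli1// ge0_integral_distribution//.
  exact: measurable_fun_fubini_tonelli_F.
by move=> y; apply: integral_ge0.
Qed.

End independent_pair.

Section tuple_boxes.
Variables (d : measure_display) (T : measurableType d) (n : nat).

Definition tuple_box (C : 'I_n -> set T) : set (n.-tuple T) :=
  [set t | forall i, C i (tnth t i)].

Definition tuple_boxes : set (set (n.-tuple T)) :=
  [set tuple_box C | C in [set C | forall i, measurable (C i)]].

Lemma tuple_box_measurable C : (forall i, measurable (C i)) ->
  measurable (tuple_box C).
Proof.
move=> mC; rewrite (_ : tuple_box C = \bigcap_(i in [set: 'I_n])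
    ((fun t => tnth t i) @^-1` C i)).
  apply: fin_bigcap_measurable => // i _.
  by have := measurable_tnth i measurableT (mC i); rewrite setTI.
by apply/seteqP; split => t tC i; [move=> _|]; exact: tC.
Qed.

Lemma tuple_boxes_generate : @measurable _ (n.-tuple T) = <<s tuple_boxes >>.
Proof.
apply/seteqP; split; last first.
  apply: smallest_sub; first exact: sigma_algebra_measurable.
  by move=> _ [C mC <-]; exact: tuple_box_measurable.
apply: smallest_sub; first exact: smallest_sigma_algebra.
rewrite -bigcup_seq => A [i _ [B mB <-]].
apply: sub_sigma_algebra; exists (fun j => if j == i then B else setT).
  by move=> j; case: ifP.
apply/seteqP; split=> t /=; rewrite ?setTI.
  by move=> /(_ i); rewrite eqxx.
by move=> [_ Bt] j; case: eqP => // ->.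
Qed.

Lemma tuple_boxes_setI : setI_closed tuple_boxes.
Proof.
move=> _ _ [C mC <-] [D mD <-]; exists (fun i => C i `&` D i).
  by move=> i; exact: measurableI.
apply/seteqP; split=> t; first by move=> CD; split=> i; have [] := CD i.
by move=> [Ct Dt] i; split.
Qed.

End tuple_boxes.

Section iid_sequence.
Variables (R : realType) (d : measure_display) (T : measurableType d).
Variables (P : probability T R) (eta : nat -> {mfun T >-> measurableTypeR R}).
Variable mu : probability (measurableTypeR R) R.
Hypothesis eta_iid : forall n (B : nat -> set (measurableTypeR R)),
  (forall i, measurable (B i)) ->
  P (\bigcap_(i in `I_n) (eta i @^-1` B i)) = (\prod_(i < n) mu (B i))%E.

Definition past n (w : T) : n.-tuple (measurableTypeR R) :=
  [tuple (eta i w : measurableTypeR R) | i < n].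

Lemma past_measurable n : measurable_fun setT (past n).
Proof.
apply/measurable_fun_tnthP => i.
rewrite (_ : _ \o _ = eta i); first exact: measurable_funP.
by apply/funext => w; rewrite /= tnth_mktuple.
Qed.

Lemma past_independent n (A : set (n.-tuple (measurableTypeR R)))
    (B : set (measurableTypeR R)) : measurable A -> measurable B ->
  P (past n @^-1` A `&` eta n @^-1` B) = (P (past n @^-1` A) * mu B)%E.
Proof.
move=> mA mB.
have mE : measurable (eta n @^-1` B).
  by rewrite -[X in measurable X]setTI; exact: measurable_funP.
pose V : {mfun T >-> n.-tuple (measurableTypeR R)} :=
  HB.pack (past n) (isMeasurableFun.Build _ _ _ _ _ (@past_measurable n)).
have muB0 : 0 <= fine (mu B) by rewrite fine_ge0.
(* For fixed [B], both sides are finite measures in [A], so it suffices to compare them on boxes,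
   which are stable under intersection and generate. *)
pose m1 := measure_function_pushforward__canonical__measure_function_Measure
  (mrestr P mE) (@past_measurable n).
pose m2 := mscale (NngNum muB0) (distribution P V).
have muBE : (fine (mu B))%:E = mu B by rewrite fineK// fin_num_measure.
have m1E X : m1 X = P (past n @^-1` X `&` eta n @^-1` B) by [].
have m2E X : m2 X = (P (past n @^-1` X) * mu B)%E by rewrite -muBE muleC.
rewrite -m1E -m2E.
apply: (measure_unique (@tuple_boxes _ (measurableTypeR R) n) (fun=> setT)
  _ _ _ _ m1 m2) => //.
- exact: tuple_boxes_generate.
- exact: tuple_boxes_setI.
- move=> _; exists (fun=> setT) => //.
  by apply/seteqP; split.
- by rewrite bigcup_const.
- move=> _ [C mC <-].
  (* Puts [B] at index n after the sides of the box, so that the product formula for n + 1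
     innovations covers the joint event. *)
  pose D i := if insub i is Some j then C (j : 'I_n) else B.
  have mD i : measurable (D i) by rewrite /D; case: insubP.
  have DC (j : 'I_n) : D j = C j by rewrite /D valK.
  have Dn : D n = B by rewrite /D insubF// ltnn.
  have boxE : past n @^-1` (tuple_box C) = \bigcap_(i in `I_n) (eta i @^-1` D i).
    apply/seteqP; split=> w.
      move=> Cw i /= ni; have := Cw (Ordinal ni).
      by rewrite tnth_mktuple -DC.
    by move=> Dw i; rewrite tnth_mktuple -DC; exact: (Dw i (ltn_ord i)).
  have boxSE : past n @^-1` (tuple_box C) `&` eta n @^-1` B =
      \bigcap_(i in `I_n.+1) (eta i @^-1` D i).
    by rewrite boxE bigcap_mkord bigcap_mkord big_ord_recr /= Dn.
  by rewrite [LHS]m1E [RHS]m2E boxSE boxE !eta_iid// big_ord_recr /= Dn.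
- move=> _; apply: le_lt_trans (probability_le1 P _) _; last by rewrite ltry.
  by apply: measurableI => //; rewrite preimage_setT.
Qed.

End iid_sequence.

Section autoregressive_state.
Variables (R : realType) (q : nat) (a : 'rV[R]_q).
Implicit Types e : nat -> R.

(** The starting value 0 is arbitrary: q pushes erase it, and from then on the state consists of the
    last q innovations. *)
Fixpoint state e n : 'rV[R]_q :=
  if n is k.+1 then push_right (state e k) (e k) else 0.

Definition weak_survive (x : 'rV[R]_q) (y : R) : R :=
  (0 <= y + threshold a x)%R%:R.

(** The first q innovations only fill the state; testing starts with innovation q. *)
Definition alive n e : R :=
  \prod_(i < n) weak_survive (state e (q + i)) (e (q + i)%N).

Lemma eq_state e e' n : (forall i, (i < n)%N -> e i = e' i) ->
  state e n = state e' n.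
Proof.
elim: n => //= n IH ee'; rewrite IH ?ee'// => i ni.
by rewrite ee'// ltnW.
Qed.

Lemma eq_alive e e' n : (forall i, (i < q + n)%N -> e i = e' i) ->
  alive n e = alive n e'.
Proof.
move=> ee'; apply: eq_bigr => i _; rewrite ee' ?ltn_add2l//.
congr weak_survive; apply: eq_state => j ji.
by rewrite ee'// (ltn_trans ji)// ltn_add2l.
Qed.

Lemma state_coordE e n (c : 'I_q) : (q <= n + c)%N ->
  state e n 0 c = e (n + c - q)%N.
Proof.
elim: n c => [|n IH] c qnc.
  by move: qnc; rewrite add0n leqNgt ltn_ord.
rewrite /= push_rightE; case: insubP => [c' _ c'E|].
  by rewrite IH c'E ?addnS// -addSn.
rewrite -leqNgt => qc; congr e.
have := ltn_ord c; move: qnc qc; lia.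
Qed.

Lemma alive_ge0 n e : 0 <= alive n e.
Proof. by apply: prodr_ge0 => i _; rewrite /weak_survive ler0n. Qed.

Lemma weak_survive_measurable2 : coord_measurable2 weak_survive.
Proof.
move=> d S X Y mX mY; rewrite /weak_survive.
apply: (@measurableT_comp _ _ _ _ _ _ (fun b : bool => b%:R : R)) => //.
apply: measurable_fun_ler => //; apply: measurable_funD => //.
exact: threshold_measurable.
Qed.

Lemma state_measurable d (S : measurableType d) (e : S -> nat -> R) n :
  (forall i, measurable_fun setT (fun s => e s i)) ->
  measurable_coords (fun s => state (e s) n).
Proof.
move=> me; elim: n => [|n IH] /=.
  by move=> j; under eq_fun do rewrite mxE; exact: measurable_cst.
exact: measurable_coords_push_right.
Qed.

Lemma alive_measurable d (S : measurableType d) (e : S -> nat -> R) n :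
  (forall i, measurable_fun setT (fun s => e s i)) ->
  measurable_fun setT (fun s => alive n (e s)).
Proof.
move=> me; elim: n => [|n IH].
  by under eq_fun do rewrite /alive big_ord0; exact: measurable_cst.
under eq_fun do rewrite /alive big_ord_recr /=.
apply: measurable_funM; first exact: IH.
by apply: weak_survive_measurable2 => //; exact: state_measurable.
Qed.

(** The weak and strict indicators differ only at y = - threshold, which is null. *)
Lemma transfer_weak_survive (mu : probability (measurableTypeR R) R) g :
  (forall r, mu [set r] = 0%E) -> continuous g ->
  transfer mu weak_survive g = transfer mu (survive a) g.
Proof.
move=> mu0 cg; apply/funext => x; rewrite /transfer /Rintegral; congr fine.
have mg : measurable_fun setT (fun y => g (push_right x y)).
  apply: continuous_measurable_fun => y.
  by apply: continuous_comp; [exact: push_right_continuousr|exact: cg].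
apply: ae_eq_integral => //.
- apply/measurable_EFinP; apply: measurable_funM => //.
  apply: (@measurableT_comp _ _ _ _ _ _ (fun b : bool => b%:R : R)) => //.
  by apply: measurable_fun_ler => //; apply: measurable_funD.
- apply/measurable_EFinP; apply: measurable_funM => //.
  exact: survive_measurable.
exists [set - threshold a x]; split => //; first exact: mu0.
move=> y /= ne; apply/eqP; rewrite -subr_eq0 opprK.
apply: contra_notT ne => yx _; congr (_ * _)%:E.
by rewrite /survive /weak_survive lt_neqAle eq_sym yx.
Qed.

End autoregressive_state.

Section iid_chain.
Variables (R : realType) (d : measure_display) (T : measurableType d).
Variables (P : probability T R) (eta : nat -> {mfun T >-> measurableTypeR R}).
Variable mu : probability (measurableTypeR R) R.
Hypothesis eta_iid : forall n (B : nat -> set (measurableTypeR R)),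
  (forall i, measurable (B i)) ->
  P (\bigcap_(i in `I_n) (eta i @^-1` B i)) = (\prod_(i < n) mu (B i))%E.
Variables (q : nat) (a : 'rV[R]_q).

Local Notation K := (transfer mu (survive a)).
Local Notation L := (transfer mu (fun=> cst 1)).

Definition sample (w : T) : nat -> R := fun i => eta i w.

(** The Markov property in integrated form, with [phi] a functional of the first n innovations. Its
    measurability is asked along every measurable family of sequences so that it can be evaluated on
    tuples as well as on samples. *)
Lemma integral_chain_step n (phi : (nat -> R) -> R) (h : 'rV[R]_q -> R -> R)
    (g : 'rV[R]_q -> R) :
  (forall e e', (forall i, (i < n)%N -> e i = e' i) -> phi e = phi e') ->
  (forall d' (S : measurableType d') (e : S -> nat -> R),
    (forall i, measurable_fun setT (fun s => e s i)) ->
    measurable_fun setT (fun s => phi (e s))) ->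
  (forall e, 0 <= phi e) ->
  coord_measurable2 h -> (forall x y, 0 <= h x y) ->
  coord_measurable g -> (forall x, 0 <= g x) ->
  (forall x, mu.-integrable setT (EFin \o (fun y => h x y * g (push_right x y)))) ->
  (\int[P]_w (phi (sample w) * (h (state q (sample w) n) (eta n w)
                   * g (state q (sample w) n.+1)))%:E =
   \int[P]_w (phi (sample w) * transfer mu h g (state q (sample w) n))%:E)%E.
Proof.
move=> phi_past mphi phi0 mh h0 mg g0 hg_int.
(* Padding by 0 beyond n is harmless, since [phi] and the state at time n read only the first n
   entries. *)
pose path (t : n.-tuple (measurableTypeR R)) : nat -> R := nth (0 : R) t.
have mpath i : measurable_fun setT (fun t => path t i).
  have [ni|ni] := ltnP i n.
    rewrite (_ : (fun t => _) = (fun t => tnth t (Ordinal ni))).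
      exact: measurable_tnth.
    by apply/funext => t; rewrite (tnth_nth (0 : R)).
  rewrite (_ : (fun t => _) = (fun=> 0)) ?measurable_cst//.
  by apply/funext => t; rewrite /path nth_default// size_tuple.
pose V : {mfun T >-> n.-tuple (measurableTypeR R)} :=
  HB.pack (past eta n) (isMeasurableFun.Build _ _ _ _ _ (@past_measurable _ _ _ eta n)).
have pathV w i : (i < n)%N -> path (V w) i = sample w i.
  move=> ni; transitivity (tnth (past eta n w) (Ordinal ni)).
    by rewrite (tnth_nth (0 : R)).
  by rewrite tnth_mktuple.
pose f (z : n.-tuple (measurableTypeR R) * measurableTypeR R) : \bar R :=
  (phi (path z.1) * (h (state q (path z.1) n) z.2
     * g (push_right (state q (path z.1) n) z.2)))%:E.
have mpath1 i : measurable_fun setT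
    (fun z : n.-tuple (measurableTypeR R) * measurableTypeR R => path z.1 i).
  exact: (measurableT_comp (mpath i)).
have m2 : measurable_fun setT
    (fun z : n.-tuple (measurableTypeR R) * measurableTypeR R => z.2 : R).
  exact: measurable_snd.
have mf : measurable_fun setT f.
  have mst := @state_measurable R q _ _ _ n mpath1.
  apply/measurable_EFinP; apply: measurable_funM; first exact: mphi.
  apply: measurable_funM; first exact: mh.
  exact: mg (measurable_coords_push_right mst m2).
have f0 z : (0 <= f z)%E by rewrite lee_fin !mulr_ge0.
have := @integral_independent_pair R d T P _ _ V (eta n) mu _ f mf f0.
move=> /(_ (@past_independent _ _ _ _ _ _ eta_iid n)) fV.
transitivity (\int[P]_w f (V w, eta n w))%E.
  apply: eq_integral => w _; rewrite /f /=.
  rewrite (phi_past (sample w) (path (V w))); last by move=> i /pathV.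
  by rewrite (@eq_state _ _ (sample w) (path (V w)) n)// => i /pathV.
rewrite fV; apply: eq_integral => w _.
rewrite (phi_past (sample w) (path (V w))); last by move=> i /pathV.
rewrite (@eq_state _ _ (sample w) (path (V w)) n); last by move=> i /pathV.
rewrite EFinM /transfer /Rintegral fineK; last first.
  by apply: integrable_fin_num => //; exact: hg_int.
by rewrite -integralZl//; exact: hg_int.
Qed.

Lemma integral_chain_transfer1 g n : bounded_continuous g ->
  (forall x, 0 <= g x) -> coord_measurable g ->
  (\int[P]_w (g (state q (sample w) n))%:E = (iter n L g 0)%:E)%E.
Proof.
elim: n g => [|n IH] g bg g0 mg.
  by rewrite /= integral_cst// [X in (_ * X)%E](probability_setT P) mule1.
have w1 := cst1_weight q mu.
have m1 : coord_measurable2 (fun _ : 'rV[R]_q => cst 1 : R -> R).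
  by move=> *; exact: measurable_cst.
rewrite iterSr -IH; last 3 first.
- exact: transfer_bounded_continuous.
- exact: (transfer_ge0 w1).
- exact: transfer_coord_measurable.
transitivity (\int[P]_w (1 * (1 * g (state q (sample w) n.+1)))%:E)%E.
  by apply: eq_integral => w _; rewrite !mul1r.
rewrite (@integral_chain_step n (fun=> 1) (fun=> cst 1))//.
  by under eq_integral do rewrite mul1r.
by move=> x; exact: (transfer_integrable w1 x bg).
Qed.

Hypothesis mu_atomless : forall r, mu [set r] = 0%E.

(** The last innovation is integrated out first, turning [g] into [K g]; this is why the induction
    keeps [g] general. *)
Lemma integral_alive g n : bounded_continuous g ->
  (forall x, 0 <= g x) -> coord_measurable g ->
  (\int[P]_w (alive a n (sample w) * g (state q (sample w) (q + n)))%:E =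
   \int[P]_w (iter n K g (state q (sample w) q))%:E)%E.
Proof.
have sw := survive_weight a mu_atomless.
elim: n g => [|n IH] g bg g0 mg.
  by apply: eq_integral => w _; rewrite /alive big_ord0 mul1r addn0.
rewrite iterSr -IH; last 3 first.
- exact: transfer_bounded_continuous.
- exact: (transfer_ge0 sw).
- by apply: transfer_coord_measurable => //; exact: survive_measurable2.
under eq_integral do rewrite /alive big_ord_recr /= addnS -mulrA.
rewrite -transfer_weak_survive//; last by case: bg.
apply: integral_chain_step => //.
- by move=> e e1 ee1; exact: (eq_alive a ee1).
- by move=> d1 S e me; exact: (alive_measurable a n me).
- by move=> ?; exact: alive_ge0.
- exact: weak_survive_measurable2.
move=> x; have [cg [M gM]] := (bounded_continuousP _).1 bg.
apply: (@bounded_integrable _ _ _ M) => [|y].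
  apply: measurable_funM.
    apply: (@measurableT_comp _ _ _ _ _ _ (fun b : bool => b%:R : R)) => //.
    by apply: measurable_fun_ler => //; apply: measurable_funD.
  apply: continuous_measurable_fun => y.
  by apply: continuous_comp; [exact: push_right_continuousr|exact: cg].
rewrite normrM (le_trans _ (gM (push_right x y)))// ler_piMl//.
by rewrite /weak_survive normr_nat lern1 leq_b1.
Qed.

Lemma integral_alive_mass n :
  (\int[P]_w (alive a n (sample w))%:E =
   (iter q L (mass mu (survive a) n) 0)%:E)%E.
Proof.
have sw := survive_weight a mu_atomless.
rewrite -integral_chain_transfer1; last 3 first.
- exact: mass_bounded_continuous.
- exact: mass_ge0.
- apply: iter_transfer_coord_measurable => //.
  + exact: survive_measurable2.
  + exact: bounded_continuous_cst.
  + by move=> *; exact: measurable_cst.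
rewrite -integral_alive.
- by apply: eq_integral => w _; rewrite mulr1.
- exact: bounded_continuous_cst.
- by move=> x; exact: ler01.
- by move=> *; exact: measurable_cst.
Qed.

End iid_chain.

(** * Persistence exponent *)

Section exponential_rate.
Variables (R : realType) (q : nat) (p : nat -> R) (beta : R).
Hypothesis beta_ge0 : 0 <= beta.
Hypothesis p_ub : forall l, beta < l ->
  exists2 C, 0 < C & forall n, p n <= C * l ^+ n.+1.
Hypothesis p_lb : forall n, beta ^+ (n.+1 + q) <= p n.

Lemma near_le_natM (D e : R) : 0 < e ->
  \forall n \near \oo, (0 < n)%N /\ D <= e * n%:R.
Proof.
move=> e0; near=> n; split; first by near: n; exact: nbhs_infty_gt.
rewrite mulrC -ler_pdivrMr//; near: n; exact: nbhs_infty_ger.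
Unshelve. all: by end_near. Qed.

Let ln_ub l C n : 0 < l -> 0 < C -> 0 < p n -> p n <= C * l ^+ n.+1 ->
  ln (p n) <= ln C + n.+1%:R * ln l.
Proof.
move=> l0 C0 pn0 pn.
rewrite mulr_natl -lnXn// -lnM ?posrE ?exprn_gt0//.
by rewrite ler_ln ?posrE// mulr_gt0 ?exprn_gt0.
Qed.

Lemma cvg_exponential_rate :
  (n%:R^-1%:E * lne (p n)%:E)%E @[n --> \oo] --> lne beta%:E.
Proof.
have [b0|b0] := eqVneq beta 0.
  rewrite b0 le0_lneNy ?lexx//; apply/cvgeNyPle => A.
  have l0 : beta < expR (A - 1) by rewrite b0 expR_gt0.
  have [C C0 pC] := p_ub l0.
  have := near_le_natM (ln C + (A - 1)) ltr01; apply: filterS => n [n0].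
  rewrite mul1r => CA; have n0' : 0 < n%:R :> R by rewrite ltr0n.
  have [pn0|pn0] := leP (p n) 0.
    by rewrite le0_lneNy ?lee_fin// gt0_muleNy ?leNye// lte_fin invr_gt0.
  rewrite lne_EFin// -EFinM lee_fin mulrC ler_pdivrMr//.
  apply: (le_trans (ln_ub (expR_gt0 _) C0 pn0 (pC n))).
  by rewrite expRK -natr1; lra.
have {}b0 : 0 < beta by rewrite lt_neqAle eq_sym b0.
have p0 n : 0 < p n by apply: lt_le_trans (p_lb n); rewrite exprn_gt0.
rewrite lne_EFin//.
have -> : (fun n => (n%:R^-1%:E * lne (p n)%:E)%E) =
    (fun n => (n%:R^-1 * ln (p n))%:E).
  by apply/funext => n; rewrite lne_EFin.
apply: cvg_EFin; first exact: nearW.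
apply/cvgrPdist_le => eps e0.
have e20 : 0 < eps / 2 by rewrite divr_gt0.
pose l := beta * expR (eps / 2).
have lb : beta < l by rewrite /l ltr_pMr// expR_gt1.
have [C C0 pC] := p_ub lb.
have l0 : 0 < l := lt_trans b0 lb.
have lnl : ln l = ln beta + eps / 2 by rewrite lnM ?posrE ?expR_gt0// expRK.
near=> n.
(* The factor [C] and the extra power of l are absorbed in eps n / 2; below, the q + 1 extra powers
   of beta in the lower bound are absorbed in eps n. *)
have [n0 nC] : (0 < n)%N /\ ln C + ln l <= eps / 2 * n%:R.
  by near: n; exact: near_le_natM.
have [_ nq] : (0 < n)%N /\ - (q.+1%:R * ln beta) <= eps * n%:R.
  by near: n; exact: near_le_natM.
have n0' : 0 < n%:R :> R by rewrite ltr0n.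
have ub := ln_ub l0 C0 (p0 n) (pC n).
have lbn : (n.+1 + q)%:R * ln beta <= ln (p n).
  rewrite mulr_natl -lnXn//.
  by rewrite ler_ln ?posrE ?exprn_gt0.
rewrite distrC ler_norml; apply/andP; split.
  rewrite lerBrDr -(ler_pM2l n0') mulrA divff ?gt_eqF// mul1r.
  apply: le_trans lbn; rewrite addSnnS natrD mulrDl.
  by move: nq; nra.
rewrite lerBlDr -(ler_pM2l n0') mulrA divff ?gt_eqF// mul1r.
apply: (le_trans ub); move: nC; rewrite lnl -[n.+1%:R]natr1.
by nra.
Unshelve. all: by end_near. Qed.

End exponential_rate.

Section stieltjes_law.
Variables (R : realType) (F : cumulativeBounded (0 : R) (1 : R)).

Let mu : probability (measurableTypeR R) R := lebesgue_stieltjes_measure F.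

Lemma lebesgue_stieltjes_itv_oc (s r : R) : s <= r ->
  mu `]s, r]%classic = (F r - F s)%:E.
Proof.
move=> sr; rewrite /mu /= /lebesgue_stieltjes_measure /measure_extension/=.
by rewrite measurable_mu_extE/= ?wlength_itv_bnd//; exact: is_ocitv.
Qed.

(** The point r lies in ]s, r], whose mass F r - F s vanishes as s tends to r from the left. *)
Lemma lebesgue_stieltjes_atomless : continuous (F : R -> R) ->
  forall r, mu [set r] = 0%E.
Proof.
move=> cF r; apply/eqP; rewrite eq_le measure_ge0 andbT.
apply/lee_addgt0Pr => e e0; rewrite add0e.
have [s sr Fs] : exists2 s, s < r & F r - F s <= e.
  have /cvgrPdist_le/(_ _ e0)[d /= d0 dF] := cF r.
  exists (r - d / 2); first by rewrite gtrBl divr_gt0.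
  apply: le_trans (ler_norm _) _; apply: dF.
  rewrite /= opprB addrC subrK gtr0_norm ?divr_gt0//.
  by rewrite ltr_pdivrMr// ltr_pMr// ltr1n.
apply: (@le_trans _ _ (mu `]s, r]%classic)).
  have mset1 : measurable ([set r] : set (measurableTypeR R)) by exact: measurable_set1.
  have moc : measurable (`]s, r]%classic : set (measurableTypeR R)).
    exact: measurable_itv.
  apply: le_measure; rewrite ?inE//.
  by move=> _ ->; rewrite /= in_itv /= sr lexx.
by rewrite (lebesgue_stieltjes_itv_oc (ltW sr)) lee_fin.
Qed.

Variables (d : measure_display) (T : measurableType d) (P : probability T R).

Lemma distribution_lebesgue_stieltjes (X : {mfun T >-> measurableTypeR R}) :
  (forall r, P (X @^-1` `]-oo, r]) = (F r)%:E) ->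
  forall B, measurable B -> P (X @^-1` B) = mu B.
Proof.
move=> XF B mB.
rewrite -[LHS]/(distribution P X B); apply/esym.
apply: lebesgue_stieltjes_measure_unique => // _ [[s r] _ <-].
have [sr|rs] := leP s r; last first.
  by rewrite set_itv_ge ?measure0// bnd_simp -leNgt ltW.
rewrite [LHS](lebesgue_stieltjes_itv_oc sr).
have -> : `]s, r]%classic = `]-oo, r]%classic `\` `]-oo, s]%classic :> set R.
  apply/seteqP; split=> z /=; rewrite !in_itv /=.
    by move=> /andP[sz ->]; split=> //; apply/negP; rewrite -ltNge.
  by move=> [-> /negP]; rewrite -ltNge => ->.
have mX (u : R) : measurable (X @^-1` `]-oo, u]).
  by rewrite -[X in measurable X]setTI; exact: measurable_funP.
rewrite -[RHS]/(P (X @^-1` `]-oo, r] `\` X @^-1` `]-oo, s])).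
rewrite measureD//.
- rewrite setIidr; first by rewrite EFinB -!XF.
  by move=> w /=; rewrite !in_itv /= => /le_trans; apply.
- by apply: (le_lt_trans (probability_le1 P _)) => //; rewrite ltry.
Qed.

End stieltjes_law.

(** The default value of the minimum is also its first term, so it adds no condition. *)
Lemma bigmin_iota_ge0 (R : realDomainType) (f : nat -> R) n :
  (0 <= \big[Num.min/f 0%N]_(0 <= i < n.+1) f i) =
  all (fun i => 0 <= f i) (iota 0 n.+1).
Proof.
have le_bigmin x (s : seq nat) : (0 <= \big[Num.min/x]_(i <- s) f i) =
    (0 <= x) && all (fun i => 0 <= f i) s.
  elim: s => [|i s IH]; first by rewrite big_nil andbT.
  by rewrite big_cons le_min IH /= andbCA.
by rewrite le_bigmin /index_iota subn0 /= andbA andbb.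
Qed.

Lemma aliveE (R : realType) (q : nat) (a : 'rV[R]_q) n (e : nat -> R) :
  alive a n e = (all (fun i => 0 <= e (q + i)%N + threshold a (state q e (q + i)))
                   (iota 0 n))%:R.
Proof.
elim: n => [|n IH]; first by rewrite /alive big_ord0.
have -> : iota 0 n.+1 = iota 0 n ++ [:: n] by rewrite -addn1 iotaD.
rewrite /alive big_ord_recr /= -/(alive a n e) IH all_cat /= andbT -mulnb.
by rewrite natrM.
Qed.

(** * The persistence probability as an iterate of the operators *)

Section persistence_probability.
Variables (R : realType) (q : nat) (a : 'rV[R]_q).
Variables (d : measure_display) (T : measurableType d) (P : probability T R).
Variable xi : int -> {RV P >-> R}.
Variable mu : probability (measurableTypeR R) R.
Hypothesis xi_indep : mutually_independent [set i : int | - q%:Z <= i] xi.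
Hypothesis xi_law : forall i : int, - q%:Z <= i ->
  forall B : set R, measurable B -> P (xi i @^-1` B) = mu B.

Lemma reindexed_measurable k : measurable_fun setT
  (fun w => xi (k%:Z - q%:Z) w : measurableTypeR R).
Proof. exact: (measurable_funP (xi (k%:Z - q%:Z))). Qed.

(** The shift by q makes the indices natural: the variables xi_(-q), ..., xi_(-1) fill the state,
    and Z_i tests innovation q + i. *)
Definition reindexed k : {mfun T >-> measurableTypeR R} :=
  HB.pack (fun w => xi (k%:Z - q%:Z) w : measurableTypeR R)
    (isMeasurableFun.Build _ _ _ _ _ (@reindexed_measurable k)).

Lemma reindexed_iid n (B : nat -> set (measurableTypeR R)) :
  (forall i, measurable (B i)) ->
  P (\bigcap_(i in `I_n) (reindexed i @^-1` B i)) = (\prod_(i < n) mu (B i))%E.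
Proof.
move=> mB; pose s := [seq i%:Z - q%:Z | i <- iota 0 n].
pose J := [fset x in s]%fset; pose B' (z : int) := B (absz (z + q%:Z)).
have qk (k : nat) : - q%:Z <= k%:Z - q%:Z by lia.
have JE i : (i \in J) = (i \in s) by rewrite !inE.
have sE : perm_eq (enum_fset J) s.
  apply: uniq_perm; [exact: fset_uniq| |by move=> i; rewrite -JE].
  by rewrite map_inj_uniq ?iota_uniq// => i j /addIr [].
have := @xi_indep J B'.
have -> : \bigcap_(i in [set` J]) (xi i @^-1` B' i) =
    \bigcap_(i in `I_n) (reindexed i @^-1` B i).
  apply/seteqP; split => w Bw.
    move=> i /= ni; have := Bw (i%:Z - q%:Z).
    rewrite /B' /= subrK absz_nat; apply.
    by rewrite JE; apply/mapP; exists i => //; rewrite mem_iota.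
  move=> i /=; rewrite JE => /mapP[k]; rewrite mem_iota /= => nk ->.
  by rewrite /B' subrK absz_nat; exact: Bw.
move=> ->; last 2 first.
- by move=> i /=; rewrite JE => /mapP[k _ ->]; exact: qk.
- by move=> i; exact: mB.
rewrite (perm_big _ sE) big_map -[n in iota 0 n]subn0 -/(index_iota 0 n) big_mkord.
apply: eq_bigr => i _; rewrite xi_law//; last exact: mB.
by rewrite /B' subrK absz_nat.
Qed.

Lemma moving_averageE i w : moving_average a (fun i w => xi i w) i w =
  reindexed (q + i) w + threshold a (state q (sample reindexed w) (q + i)).
Proof.
rewrite /moving_average; congr (_ + _).
  by rewrite /=; congr (xi _ w); lia.
apply: eq_bigr => j _; congr (_ * _).
have jq := ltn_ord j.
rewrite state_coordE ?leq_addr -?addnA ?leq_addr// /sample /=.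
by congr (xi _ w); lia.
Qed.

Hypothesis mu_atomless : forall r, mu [set r] = 0%E.

Let Z : nat -> T -> R := moving_average a (fun i w => xi i w).

Lemma persistence_probability n :
  P [set w | (0 <= \big[Num.min/Z 0%N w]_(0 <= i < n.+1) Z i w)%R] =
  (iter q (transfer mu (fun=> cst 1)) (mass mu (survive a) n.+1) 0)%:E.
Proof.
rewrite -(integral_alive_mass reindexed_iid _ mu_atomless).
set A := [set w | _].
have aliveA w : alive a n.+1 (sample reindexed w) = \1_A w.
  rewrite aliveE indicE; congr (nat_of_bool _)%:R.
  rewrite (_ : w \in A = (0 <= \big[Num.min/Z 0%N w]_(0 <= i < n.+1) Z i w)).
    by rewrite bigmin_iota_ge0; apply: eq_all => i; rewrite /Z moving_averageE.
  by apply/idP/idP; rewrite inE.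
have mA : measurable A.
  have malive : measurable_fun setT (fun w => alive a n.+1 (sample reindexed w)).
    apply: alive_measurable => i; exact: (measurable_funP (reindexed i)).
  have -> : A = (fun w => alive a n.+1 (sample reindexed w)) @^-1` [set 1].
    apply/seteqP; split => w /=; rewrite aliveA indicE.
      by move=> Aw; rewrite mem_set.
    by case: (boolP (w \in A)) => [/set_mem//|_ /eqP]; rewrite eq_sym oner_eq0.
  by rewrite -[X in measurable X]setTI; exact: malive.
under eq_integral do rewrite aliveA.
by rewrite integral_indic// setIT.
Qed.

End persistence_probability.

Theorem theorem2p1 (R : realType) (q : nat) (hq : (1 <= q)%N) (a : 'rV[R]_q)
    (F : cumulativeBounded (0 : R) (1 : R)) (contF : continuous (F : R -> R)) :
  exists beta : R,
    forall (d : measure_display) (T : measurableType d) (P : probability T R)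
      (xi : int -> {RV P >-> R}),
      mutually_independent [set i : int | - q%:Z <= i] xi ->
      (forall i : int, - q%:Z <= i ->
         forall r : R, cdf (xi i) r = (F r)%:E) ->
      let Z : nat -> T -> R := moving_average a (fun i w => xi i w) in
      (P [set w | (0 <= Z 0%N w)%R] < 1)%E ->
      let K := persistence_operator F a in
      [/\ 0 <= beta < 1,
          (n%:R^-1%:E *
             lne (P [set w |
               (0 <= \big[Num.min/Z 0%N w]_(0 <= i < n.+1) Z i w)%R]))%E
            @[n --> \oo] --> lne beta%:E,
          (forall g, bounded_continuous g -> bounded_continuous (K g)) &
          0 < beta ->
            is_largest_eigenvalue K beta /\
            exists psi : 'rV[R]_q -> R,
              [/\ is_eigenfunction K beta psi,
                  forall x, 0 <= psi x &
                  continuous psi]].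
Proof.
pose mu : probability (measurableTypeR R) R := lebesgue_stieltjes_measure F.
have mu0 : forall r, mu [set r] = 0%E := lebesgue_stieltjes_atomless contF.
have sw := survive_weight a mu0.
have w1 := cst1_weight q mu.
(* This number involves only [F] and [a], so it serves every probability space. *)
exists (growth_rate mu (survive a)) => d T P xi indep law Z PZ0 K.
have KE : K = transfer mu (survive a).
  apply/funext => g; apply/funext => x.
  rewrite /K /persistence_operator Rintegral_mkcond.
  apply: eq_Rintegral => y _; rewrite /survive patchE.
  case: ifPn => [/set_mem /= y_in|/negP y_out].
    by rewrite /threshold y_in mul1r.
  rewrite (_ : (0 < _) = false) ?mul0r//.
  by apply/negP => y_in; apply: y_out; exact: mem_set.
have xi_law i : - q%:Z <= i -> forall B : set R, measurable B -> P (xi i @^-1` B) = mu B.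
  move=> qi.
  pose X : {mfun T >-> measurableTypeR R} := HB.pack (xi i : T -> measurableTypeR R)
    (isMeasurableFun.Build _ _ _ _ (xi i : T -> measurableTypeR R)
      (measurable_funP (xi i))).
  exact: (@distribution_lebesgue_stieltjes _ F _ _ P X (law i qi)).
pose p n := iter q (transfer mu (fun=> cst 1)) (mass mu (survive a) n.+1) 0.
have pE n : P [set w | (0 <= \big[Num.min/Z 0%N w]_(0 <= i < n.+1) Z i w)%R] = (p n)%:E.
  exact: persistence_probability.
have mass_le n x : mass mu (survive a) (n.+1 + q) x <= p n.
  rewrite addnC /mass iterD.
  rewrite /p (@iter_transfer1_cst _ _ _ _ _ 0 x)//.
  apply: le_iter_survive_transfer1 => //; first exact: (mass_bounded_continuous sw n.+1).
  exact: (mass_ge0 sw n.+1).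
split.
- rewrite growth_rate_ge0//=.
  (* [K^(1+q) 1] is bounded, uniformly in the state, by [p 0], the probability that Z_0 >= 0, which
     is less than 1. *)
  apply: (@growth_rate_lt1 _ _ _ _ sw (1 + q) (p 0)) => //.
  rewrite -lte_fin -pE; apply: le_lt_trans PZ0; rewrite le_eqVlt; apply/orP; left.
  apply/eqP; congr (P _); apply/seteqP; split=> w /=;
    by rewrite bigmin_iota_ge0 /= andbT.
- under eq_fun do rewrite pE.
  apply: (@cvg_exponential_rate _ q).
  + exact: growth_rate_ge0.
  + move=> l /(mass_ub sw)[C C0 massC]; exists C => // n.
    apply: le_trans (ler_norm _) _; apply: (iter_transfer_bounded w1).
      exact: mass_bounded_continuous.
    by move=> x; rewrite ger0_norm ?mass_ge0.
  + by move=> n; apply: (growth_rate_exp_le sw).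
- by rewrite KE => g; exact: transfer_bounded_continuous.
rewrite KE => b0; have [psi [psiP psi0]] := survival_eigenfunction mu0 b0.
split; last by exists psi; split=> //; case: psiP => -[].
split; first by exists psi.
by move=> l; exact: eigenvalue_le_growth_rate.
Qed.
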